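(* Let $K$ be an imaginary quadratic field, $f_\rho$ and $d$ positive integers, $N=(D_Kf_\rho)^2d^2$, and $\underline{\mathfrak c}=f_\rho\sqrt{D_K}\mathcal O_K$. For each positive divisor $d''$ of $d^2$ let $\iota_{d''}:F(\mathcal{E}ll(\mathcal O_K),f_\rho)\to S_2(\Gamma_1(N))$, $g\mapsto g|[\mathrm{diag}(d'',1)]_2$. Then the union of the images $\iota_{d''}(F(\mathcal{E}ll(\mathcal O_K),f_\rho))$ over all $d''\mid d^2$ contains: every Hecke theta function $\vartheta(\tau;\varphi)$ of a Hecke character $\varphi$ of $K$ of infinity type $[-1/2;1,0]$ whose conductor $\mathfrak c_f$ divides $\underline{\mathfrak c}$, and every function $\vartheta(\tau;\varphi)|[\mathrm{diag}(d'd'',1)]_2$ with such $\varphi$, $d''\mid d^2$, and $d'=\mathrm{Nm}_{K/\mathbb Q}(\mathfrak q_r)$ for some integral ideal $\mathfrak q_r$ dividing $\underline{\mathfrak c}\,\mathfrak c_f^{-1}$.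
   Context: Embed $K\subset\mathbb C$ with $\sqrt{D_K}$ in the upper half plane $\mathcal H$; $D_K<0$ the discriminant, $h$ the class number. Hecke character of infinity type $[-1/2;1,0]$ with conductor $\mathfrak c_f$: a homomorphism $\varphi$ from fractional ideals prime to $\mathfrak c_f$ to $\mathbb C^\times$ with $\varphi(\alpha\mathcal O_K)=\alpha\chi'_\varphi(\alpha)$ for $\alpha\in\mathcal O_K$ prime to $\mathfrak c_f$, $\chi'_\varphi$ a character of $(\mathcal O_K/\mathfrak c_f)^\times$, $\mathfrak c_f$ minimal. $\vartheta(\tau;\varphi)=\sum_I\varphi(I)e^{2\pi i\tau\mathrm{Nm}(I)}$ over nonzero integral ideals ($\varphi(I)=0$ if $I$ not prime to $\mathfrak c_f$). $(f|[\mathrm{diag}(r,1)]_2)(\tau)=rf(r\tau)$. Let $z_1,\dots,z_h\in\mathcal H$ represent the $\mathbb C$-isomorphism classes of elliptic curves with CM by $\mathcal O_K$; for $z=z_a$ let $(a_z,b_z,c_z)$ coprime, $a_z>0$, $a_zz^2+b_zz+c_z=0$. $\Lambda_a$: lattice with basis $e_2,e_1$ and Gram matrix $f_\rho\begin{pmatrix}2a_z&b_z\\ b_z&2c_z\end{pmatrix}$; $G_{\Lambda_a}=\Lambda_a^\vee/\Lambda_a$; $\Omega'_a$ the $\mathbb Q$-linear map with $\Omega'_a(e_2)=\sqrt{2a_zf_\rho}$, $\Omega'_a(e_1)=-\sqrt{2a_zf_\rho}z$; $f_a(\tau;\beta)=\sum_{y\in\Lambda_a^\vee,\,y+\Lambda_a=\beta}\Omega'_a(y)e^{\pi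 if_\rho|D_K|\tau(y,y)}$ for $\beta\in G_{\Lambda_a}$. $F(\mathcal{E}ll(\mathcal O_K),f_\rho)$ is the $\mathbb C$-span of all $f_a(\tau;\beta)$; it is contained in $S_2(\Gamma_1((D_Kf_\rho)^2))$. *)

(* Defs.v *)
From HB Require Import structures.
From mathcomp Require Import all_boot all_order all_algebra.
From mathcomp Require Import boolp classical_sets fsbigop reals sequences exp trigo.
From mathcomp Require Import complex.
From Stdlib Require List.

Set Implicit Arguments.
Unset Strict Implicit.
Unset Printing Implicit Defensive.

Import Order.TTheory GRing.Theory Num.Theory.
Local Open Scope classical_set_scope.
Local Open Scope ring_scope.
Local Open Scope complex_scope.

Section HeckeTheta.
Variable R : realType.
Local Notation C := R[i].

(* The imaginary quadratic field K, given by its discriminant D < 0.  *)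

Definition sqfree_nat (m : nat) : Prop :=
  forall p : nat, prime p -> ~ (p * p %| m)%N.

Definition neg_fund_disc (D : int) : Prop :=
  D < 0 /\
  ( ((D %% 4)%Z = 1 /\ sqfree_nat `|D|%N) \/
    (exists m : int, D = 4 * m /\ ((m %% 4)%Z = 2 \/ (m %% 4)%Z = 3)
                     /\ sqfree_nat `|m|%N) ).

Definition sqrtD (D : int) : C := 0 +i* Num.sqrt (`|D|%:~R : R).

Definition omegaK (D : int) : C := (D%:~R + sqrtD D) / 2.

Definition OK (D : int) : set C :=
  [set x | exists m n : int, x = m%:~R + n%:~R * omegaK D].

Definition is_ideal (D : int) (I : set C) : Prop :=
  [/\ I `<=` OK D,
      I 0,
      (forall x y, I x -> I y -> I (x + y)),
      (forall r x, OK D r -> I x -> I (r * x)) &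
      (exists x, I x /\ x != 0)].

Definition idsum (I J : set C) : set C :=
  [set z | exists x y, [/\ I x, J y & z = x + y]].

Definition idmul (I J : set C) : set C :=
  [set z | exists s : seq (C * C),
      (forall p, List.In p s -> I p.1 /\ J p.2) /\
      z = \sum_(p <- s) p.1 * p.2].

Definition principal (D : int) (a : C) : set C := [set a * x | x in OK D].

Definition coprime_id (D : int) (I m : set C) : Prop := idsum I m = OK D.

Definition iddvd (D : int) (I J : set C) : Prop :=
  exists K, is_ideal D K /\ J = idmul I K.

Definition idnorm (D : int) (I : set C) (n : nat) : Prop :=
  exists r : 'I_n -> C,
    (forall k, OK D (r k)) /\
    (forall x, OK D x -> exists! k, I (x - r k)).

(** chi is (the lift to O_K of) a character of (O_K/m)^x *)
Definition char_mod (D : int) (m : set C) (chi : C -> C) : Prop :=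
  [/\ (forall a b, OK D a -> OK D b ->
         coprime_id D (principal D a) m -> coprime_id D (principal D b) m ->
         m (a - b) -> chi a = chi b),
      (forall a b, OK D a -> OK D b ->
         coprime_id D (principal D a) m -> coprime_id D (principal D b) m ->
         chi (a * b) = chi a * chi b) &
      chi 1 = 1].

(** phi : homomorphism from the ideals prime to m to C^x with
    phi(alpha O_K) = alpha chi(alpha) for alpha in O_K prime to m.
    (phi is given on integral ideals prime to m.) *)
Definition hecke_mod (D : int) (m : set C) (phi : set C -> C) : Prop :=
  exists chi : C -> C,
  [/\ char_mod D m chi,
      (forall I, is_ideal D I -> coprime_id D I m -> phi I != 0),
      (forall I J, is_ideal D I -> is_ideal D J ->
         coprime_id D I m -> coprime_id D J m ->
         phi (idmul I J) = phi I * phi J) &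
      (forall a, OK D a -> a != 0 -> coprime_id D (principal D a) m ->
         phi (principal D a) = a * chi a)].

(** phi is a Hecke character of infinity type [-1/2;1,0] with conductor cf:
    cf is a modulus for phi and it is minimal. *)
Definition hecke_char_conductor (D : int) (cf : set C) (phi : set C -> C) : Prop :=
  [/\ is_ideal D cf,
      hecke_mod D cf phi &
      (forall m, is_ideal D m -> iddvd D m cf -> m <> cf ->
         ~ exists psi, hecke_mod D m psi /\
             (forall I, is_ideal D I -> coprime_id D I cf -> psi I = phi I))].

Definition e2pi (w : C) : C :=
  (expR (- (2 * pi * complex.Im w)))%:C *
  (cos (2 * pi * complex.Re w) +i* sin (2 * pi * complex.Re w)).

Definition qconv (c : nat -> C) (tau l : C) : Prop :=
  forall eps : R, 0 < eps -> exists N : nat, forall M : nat, (N <= M)%N ->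
    `| \sum_(n < M) c n * e2pi (n%:R * tau) - l | < eps%:C.

(** value of sum_n c_n e^{2 pi i n tau} (0 if it does not converge) *)
Definition qval (c : nat -> C) (tau : C) : C :=
  match pselect (exists l, qconv c tau l) with
  | left P => projT1 (cid P)
  | right _ => 0
  end.

Definition upper (tau : C) : Prop := 0 < complex.Im tau.

Definition slash_diag (r : nat) (f : C -> C) : C -> C :=
  fun tau => r%:R * f (r%:R * tau).

Definition theta_coef (D : int) (cf : set C) (phi : set C -> C) (n : nat) : C :=
  \sum_(I \in [set I | [/\ is_ideal D I, coprime_id D I cf & idnorm D I n]])
     phi I.

Definition theta (D : int) (cf : set C) (phi : set C -> C) : C -> C :=
  qval (theta_coef D cf phi).

Definition lattice_tau (tau : C) : set C :=
  [set x | exists m n : int, x = m%:~R + n%:~R * tau].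

(** C/(Z + Z tau) has CM by O_K: End = {a | a L <= L} = O_K *)
Definition cm_by_OK (D : int) (tau : C) : Prop :=
  [set a | forall x, lattice_tau tau x -> lattice_tau tau (a * x)] = OK D.

(** C/L_tau and C/L_tau' are isomorphic over C (homothetic lattices) *)
Definition iso_curves (tau tau' : C) : Prop :=
  exists l : C, l != 0 /\ lattice_tau tau' = [set l * x | x in lattice_tau tau].

Definition cm_reps (D : int) (zs : seq C) : Prop :=
  [/\ (forall z, z \in zs -> upper z /\ cm_by_OK D z),
      (forall i j, (i < size zs)%N -> (j < size zs)%N ->
         iso_curves (nth 0 zs i) (nth 0 zs j) -> i = j) &
      (forall tau, upper tau -> cm_by_OK D tau ->
         exists2 z, z \in zs & iso_curves tau z)].

(** data of a generator f_a(tau; beta): the point z = z_a, its primitive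
    equation (a_z, b_z, c_z), and a representative y0 = x2 e2 + x1 e1
    (coordinates (x2, x1)) of beta in Lambda_a^dual. *)
Record Fgen := MkFgen {
  fg_z : C; fg_a : int; fg_b : int; fg_c : int; fg_y0 : rat * rat }.

Definition gram (f : nat) (a b c : int) (y : rat * rat) : rat :=
  f%:R * (2 * a%:~R * y.1 ^+ 2 + 2 * b%:~R * y.1 * y.2 + 2 * c%:~R * y.2 ^+ 2).

Definition is_int_rat (x : rat) : Prop := exists k : int, x = k%:~R.

(** y in the dual lattice: (y, e2) and (y, e1) are integers *)
Definition in_dual (f : nat) (a b c : int) (y : rat * rat) : Prop :=
  is_int_rat (f%:R * (2 * a%:~R * y.1 + b%:~R * y.2)) /\
  is_int_rat (f%:R * (b%:~R * y.1 + 2 * c%:~R * y.2)).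

Definition Omega' (f : nat) (z : C) (a : int) (y : rat * rat) : C :=
  (Num.sqrt ((2 * a * f%:Z)%:~R : R))%:C * ((ratr y.1 : C) - (ratr y.2 : C) * z).

(** coefficient of e^{2 pi i n tau} in
    f_a(tau;beta) = sum_{y in beta} Omega'(y) e^{pi i f |D| tau (y,y)} *)
Definition fa_coef (D : int) (f : nat) (g : Fgen) (n : nat) : C :=
  \sum_(y \in [set y : rat * rat |
          [/\ is_int_rat (y.1 - (fg_y0 g).1), is_int_rat (y.2 - (fg_y0 g).2) &
              (f * `|D|)%:R * gram f (fg_a g) (fg_b g) (fg_c g) y = 2 * n%:R]])
     Omega' f (fg_z g) (fg_a g) y.

Definition fa (D : int) (f : nat) (g : Fgen) : C -> C := qval (fa_coef D f g).

Definition valid_gen (D : int) (f : nat) (zs : seq C) (g : Fgen) : Prop :=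
  [/\ fg_z g \in zs,
      0 < fg_a g,
      gcdz (gcdz (fg_a g) (fg_b g)) (fg_c g) = 1,
      (fg_a g)%:~R * fg_z g ^+ 2 + (fg_b g)%:~R * fg_z g + (fg_c g)%:~R = 0 &
      in_dual f (fg_a g) (fg_b g) (fg_c g) (fg_y0 g)].

Definition in_iota_F (D : int) (f : nat) (zs : seq C) (e : nat) (h : C -> C) : Prop :=
  exists L : seq (C * Fgen),
    (forall p, List.In p L -> valid_gen D f zs p.2) /\
    (forall tau, upper tau ->
       h tau = slash_diag e (fun t => \sum_(p <- L) p.1 * fa D f p.2 t) tau).

Definition in_union_iota (D : int) (f d : nat) (zs : seq C) (h : C -> C) : Prop :=
  exists e : nat, [/\ (0 < e)%N, (e %| d ^ 2)%N & in_iota_F D f zs e h].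

End HeckeTheta.

(* Main.v *)
(** For [z] a root of a primitive form [(a, b, c)] of discriminant [D], put
    [L = Z + Z z].  Primitivity gives [L * (a conj L) = O], so [a conj L] is the
    inverse of [L], and every nonzero ideal [J] is [x (a conj L)] for exactly one
    representative [z] and for an [x] in [L] unique up to units; its norm is
    [a |x|^2].  Multiplication by [delta = f sqrt D] carries the dual lattice onto
    [L], so up to a nonzero constant [f_a] is the sum of [x q^(a |x|^2)] over
    a coset of [delta L] in [L].

    Write [d' theta(d' tau)] as a sum over the ideals [q I] with [I] prime to [cf],
    and put [G(x) = phi I] when [q I = x (a conj L)].  Then [G(x) / x] only depends
    on [x] modulo [delta L]: choose [g] in [I] congruent to [1] modulo [cf] and [B]
    with [I B = (g)]; if [x' = x] modulo [delta L], the ideal [I'] attached to [x']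
    is [(x'/x) I], and cancelling [q] in [q K cf = (delta)] shows that
    [g' = (x'/x) g] is again congruent to [1] modulo [cf].  As [I' B = (g')],
    comparing [phi I * phi B = g] with [phi I' * phi B = g'] gives the claim.
    So the theta function is a combination of the [f_a], divided by the number of
    units because each ideal is hit once for each unit. *)

Require Import Defs.
From HB Require Import structures.
From mathcomp Require Import all_boot all_order all_algebra.
From mathcomp Require Import finmap boolp classical_sets functions cardinality fsbigop.
From mathcomp Require Import reals topology normedtype sequences exp trigo.
From mathcomp Require Import complex.
From mathcomp Require Import ring lra zify.

Set Implicit Arguments.
Unset Strict Implicit.
Unset Printing Implicit Defensive.

Import Order.TTheory GRing.Theory Num.Theory.
Import numFieldNormedType.Exports.
Local Open Scope classical_set_scope.
Local Open Scope ring_scope.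
Local Open Scope complex_scope.

(** * Coordinates with respect to a lattice basis [1, z] *)

Section Coordinates.
Variable R : realType.
Local Notation C := R[i].
Local Notation cj := (@conjc R).

Lemma Im_intM (n : int) (z : C) : complex.Im (n%:~R * z) = n%:~R * complex.Im z.
Proof.
by rewrite -(rmorph_int (real_complex R)); case: z => x y /=; rewrite mul0r addr0.
Qed.

Lemma Im_int (n : int) : complex.Im (n%:~R : C) = 0.
Proof. by rewrite -(rmorph_int (real_complex R)). Qed.

Lemma conjc_int (n : int) : cj n%:~R = n%:~R.
Proof. by rewrite rmorph_int. Qed.

Lemma conjcD (x y : C) : cj (x + y) = cj x + cj y.
Proof. exact: rmorphD. Qed.

Lemma conjcB (x y : C) : cj (x - y) = cj x - cj y.
Proof. exact: rmorphB. Qed.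

Lemma conjcM (x y : C) : cj (x * y) = cj x * cj y.
Proof. exact: rmorphM. Qed.

Lemma ImD (x y : C) : complex.Im (x + y) = complex.Im x + complex.Im y.
Proof. by case: x; case: y. Qed.

Lemma lattice_coord (z : C) (m n m' n' : int) : 0 < complex.Im z ->
  m%:~R + n%:~R * z = m'%:~R + n'%:~R * z -> m = m' /\ n = n'.
Proof.
move=> zp e; have z0 : complex.Im z != 0 by rewrite gt_eqF.
have /eqP := congr1 (@complex.Im R) e.
rewrite !ImD !Im_int !add0r !Im_intM (inj_eq (mulIf z0)) => /eqP/intr_inj en.
by move: e; rewrite en => /addIr/intr_inj ->.
Qed.

End Coordinates.

(** * The maximal order and its discriminant *)

Section MaximalOrder.
Variables (R : realType) (D : int).
Local Notation C := R[i].
Local Notation cj := (@conjc R).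
Local Notation w := (omegaK R D).
Local Notation s := (sqrtD R D).
Local Notation O := (@OK R D).

(** [E] is the norm of [omegaK], whose minimal polynomial is X^2 - D X + E. *)
Lemma disc_mod4 : neg_fund_disc D -> exists E : int, D * D - D = 4 * E.
Proof.
case=> _ [[h _]|[m [-> _]]]; last by exists (4 * m * m - m); ring.
exists ((D %/ 4)%Z * (4 * (D %/ 4)%Z + 1)).
by have := divz_eq D 4; rewrite h => {1 2 3}->; ring.
Qed.

(** A prime [p] dividing [a], [b] and [c] would make D / p^2 a discriminant again. Squarefreeness
    excludes this except when [p = 2] and [D = 4 * m], where a congruence modulo 4 decides. *)
Lemma primitive_of_disc (a b c : int) : neg_fund_disc D ->
  b * b - 4 * a * c = D -> gcdz (gcdz a b) c = 1.
Proof.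
move=> [Dlt0 hD] hd.
have [//|g1] := eqVneq `|gcdz (gcdz a b) c|%N 1%N.
  by move=> h; rewrite -[LHS]gez0_abs ?h// gcdzE.
have g0 : `|gcdz (gcdz a b) c|%N != 0%N.
  apply/negP; rewrite absz_eq0 gcdz_eq0 gcdz_eq0 => /andP[/andP[/eqP a0 /eqP b0] _].
  by move: Dlt0; rewrite -hd a0 b0; lia.
have g2 : (1 < `|gcdz (gcdz a b) c|)%N by move: g0 g1; case: `|_|%N => [|[]].
set p := pdiv `|gcdz (gcdz a b) c|%N.
have pp : prime p by exact: pdiv_prime.
have pg : (p%:Z %| gcdz (gcdz a b) c)%Z by rewrite /dvdz/=; exact: pdiv_dvd.
have /dvdzP[a1 a1E] : (p%:Z %| a)%Z.
  by apply: dvdz_trans pg (dvdz_trans (dvdz_gcdl _ _) (dvdz_gcdl _ _)).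
have /dvdzP[b1 b1E] : (p%:Z %| b)%Z.
  by apply: dvdz_trans pg (dvdz_trans (dvdz_gcdl _ _) (dvdz_gcdr _ _)).
have /dvdzP[c1 c1E] : (p%:Z %| c)%Z by apply: dvdz_trans pg (dvdz_gcdr _ _).
have DE : D = (p%:Z * p%:Z) * (b1 * b1 - 4 * a1 * c1).
  by rewrite -hd a1E b1E c1E; ring.
have ppD : ((p * p)%N %| `|D|)%N.
  by rewrite DE abszM abszM !absz_nat dvdn_mulr.
case: hD => [[_ sf]|[m [Dm [m4 sf]]]]; first by case: (sf p pp).
(* For [p = 2], [m] is itself of the form b1^2 - 4 a1 c1, hence 0 or 1 modulo 4, while
   fundamentality requires 2 or 3. *)
have [p2|p2] := eqVneq p 2%N.
  have mE : m = b1 * b1 - 4 * a1 * c1 by move: DE; rewrite Dm p2; lia.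
  exfalso; have b1q := divz_eq b1 2.
  have b1r : (b1 %% 2)%Z = 0 \/ (b1 %% 2)%Z = 1.
    have := modz_ge0 b1 (isT : 2%:Z != 0); have := ltz_mod b1 (isT : 2%:Z != 0).
    by lia.
  move: b1q; set q := (b1 %/ 2)%Z => b1q.
  have [t [tE|tE]] : exists t : int, m = t * 4 \/ m = t * 4 + 1.
  - case: b1r => r; rewrite r in b1q.
      by exists (q * q - a1 * c1); left; rewrite mE b1q; ring.
    by exists (q * q + q - a1 * c1); right; rewrite mE b1q; ring.
  - by move: m4; rewrite tE modzMl; case.
  - by move: m4; rewrite tE modzMDl; case.
(* An odd [p] is prime to 4, so [p * p] divides [m]. *)
case: (sf p pp).
have : (p * p %| 4 * `|m|)%N by move: ppD; rewrite Dm abszM.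
rewrite Gauss_dvdr// (_ : 4%N = (2 ^ 2)%N)// coprimeXr// coprimeMl andbb.
by rewrite prime_coprime// dvdn_prime2.
Qed.

Lemma sqrtD_sq : D < 0 -> s * s = D%:~R.
Proof.
move=> D0; rewrite -(rmorph_int (real_complex R)) /sqrtD.
apply/eqP; rewrite eq_complex /= !mul0r !mulr0 addr0 sub0r -expr2.
by rewrite sqr_sqrtr ?ler0z// ltr0_norm// rmorphN /= opprK !eqxx.
Qed.

Lemma sqrtD_Im : D < 0 -> 0 < complex.Im s.
Proof. by move=> D0; rewrite /= sqrtr_gt0 ltr0z normr_gt0 lt_eqF. Qed.

Lemma conj_sqrtD : cj s = - s.
Proof. by apply/eqP; rewrite eq_complex /= oppr0 !eqxx. Qed.

Lemma omega2 : 2 * w = D%:~R + s.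
Proof. by rewrite /omegaK mulrC divfK ?pnatr_eq0. Qed.

Lemma conj_omega : cj w = D%:~R - w.
Proof.
apply: (@mulfI _ (2 : C)); first by rewrite pnatr_eq0.
have := congr1 (@conjc R) omega2; rewrite conjcD conjcM conj_sqrtD conjc_int conjc_nat.
by move=> ->; rewrite mulrBr omega2; ring.
Qed.

Lemma omega_sq (E : int) : D < 0 -> D * D - D = 4 * E ->
  w * w = D%:~R * w - E%:~R.
Proof.
move=> D0 /(congr1 (fun x : int => x%:~R : C)) hE.
apply: (@mulfI _ (4 : C)); first by rewrite pnatr_eq0.
have -> : 4 * (w * w) = (2 * w) * (2 * w) by ring.
have -> : 4 * (D%:~R * w - E%:~R) = 2 * D%:~R * (2 * w) - (4 * E)%:~R :> C by ring.
rewrite -hE omega2 mulrDl !mulrDr sqrtD_sq//; ring.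
Qed.

Lemma omega_Im : D < 0 -> 0 < complex.Im w.
Proof.
move=> D0; have := congr1 (@complex.Im R) omega2.
rewrite (_ : 2 = 2%:~R)// Im_intM ImD Im_int add0r => h.
by rewrite -(pmulr_rgt0 (x := 2))// h sqrtD_Im.
Qed.

Lemma OK_int (m : int) : O m%:~R.
Proof. by exists m, 0; rewrite mul0r addr0. Qed.

Lemma OK_nat (m : nat) : O m%:R.
Proof. exact: (OK_int m%:Z). Qed.

Lemma OK1 : O 1. Proof. exact: (OK_int 1). Qed.

Lemma OK0 : O 0. Proof. exact: (OK_int 0). Qed.

Lemma OK_omega : O w.
Proof. by exists 0, 1; rewrite mul1r add0r. Qed.

Lemma OKD x y : O x -> O y -> O (x + y).
Proof. by move=> [m [n ->]] [m' [n' ->]]; exists (m + m'), (n + n'); ring. Qed.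

Lemma OKN x : O x -> O (- x).
Proof. by move=> [m [n ->]]; exists (- m), (- n); ring. Qed.

Lemma OKM x y : neg_fund_disc D -> O x -> O y -> O (x * y).
Proof.
move=> hD [m [n ->]] [m' [n' ->]].
have [E hE] := disc_mod4 hD; have := omega_sq hD.1 hE => hw.
exists (m * m' - n * n' * E), (m * n' + n * m' + n * n' * D).
transitivity (m%:~R * m'%:~R + (m%:~R * n'%:~R + n%:~R * m'%:~R) * w
              + n%:~R * n'%:~R * (w * w)); first by ring.
by rewrite hw; ring.
Qed.

Lemma OK_conj x : O x -> O (cj x).
Proof.
move=> [m [n ->]]; exists (m + n * D), (- n).
by rewrite conjcD conjcM !conjc_int conj_omega; ring.
Qed.

Lemma OK_real x : D < 0 -> O x -> cj x = x -> exists m : int, x = m%:~R.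
Proof.
move=> D0 [m [n ->]].
rewrite conjcD conjcM !conjc_int conj_omega => e.
have [] := @lattice_coord R w (m + n * D) (- n) m n (omega_Im D0).
  by rewrite -e; ring.
by move=> _ n0; exists m; rewrite (_ : n = 0) ?mul0r ?addr0//; lia.
Qed.

End MaximalOrder.

(** For negative [D], the last equation selects the root in the upper half plane and, by squaring,
    forces the discriminant b^2 - 4ac to be [D]. *)
Definition primitive_form (R : realType) (D : int) (z : R[i]) (a b c : int) : Prop :=
  [/\ 0 < a, gcdz (gcdz a b) c = 1,
      a%:~R * z ^+ 2 + b%:~R * z + c%:~R = 0 & 2 * a%:~R * z + b%:~R = sqrtD R D].

(** * CM lattices and primitive forms of discriminant [D] *)

Section Lattices.
Variables (R : realType).
Local Notation C := R[i].
Local Notation cj := (@conjc R).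
Local Notation L := (@lattice_tau R).
Implicit Types z : C.

Lemma lat_int z (m : int) : L z m%:~R.
Proof. by exists m, 0; rewrite mul0r addr0. Qed.

Lemma lat_self z : L z z.
Proof. by exists 0, 1; rewrite mul1r add0r. Qed.

Lemma latD z x y : L z x -> L z y -> L z (x + y).
Proof. by move=> [m [n ->]] [m' [n' ->]]; exists (m + m'), (n + n'); ring. Qed.

Lemma latN z x : L z x -> L z (- x).
Proof. by move=> [m [n ->]]; exists (- m), (- n); ring. Qed.

Variables (D : int) (hD : neg_fund_disc D).
Local Notation w := (omegaK R D).
Local Notation s := (sqrtD R D).
Local Notation O := (@OK R D).

(** The last hypothesis says that [a] divides the norm k^2 + kD + E of [k + omegaK], with quotient
    [c]. The form then has discriminant D^2 - 4E = D, which makes it primitive. *)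
Lemma pf_make (a c k E : int) : D * D - D = 4 * E -> 0 < a ->
  a * c = k * k + k * D + E ->
  primitive_form D ((k%:~R + w) / a%:~R) a (- (2 * k + D)) c.
Proof.
move=> hE a0 hc.
have ne0 : (a%:~R : C) != 0 by rewrite intr_eq0 gt_eqF.
have hc' : a%:~R * c%:~R = k%:~R * k%:~R + k%:~R * D%:~R + E%:~R :> C.
  by rewrite -intrM hc; ring.
split=> //.
- by apply: (@primitive_of_disc D) => //; have := hE; nia.
- apply: (mulfI ne0); rewrite mulr0.
  transitivity ((k%:~R + w) * (k%:~R + w) - (2 * k + D)%:~R * (k%:~R + w)
     + a%:~R * c%:~R :> C); first by field.
  rewrite hc'; have -> : (k%:~R + w) * (k%:~R + w) = k%:~R * k%:~R + 2 * k%:~R * w + w * w.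
    by ring.
  by rewrite (omega_sq _ hD.1 hE); ring.
- transitivity (2 * (k%:~R + w) - (2 * k + D)%:~R :> C); first by field.
  by rewrite mulrDr omega2; ring.
Qed.

Section PrimitiveForm.
Variables (z : C) (a b c : int).
Hypothesis pf : primitive_form D z a b c.

Lemma pf_a0 : (a%:~R : C) != 0.
Proof. by case: pf => a0 _ _ _; rewrite intr_eq0 gt_eqF. Qed.

(** Conjugation changes the sign of [sqrtD], so the conjugate of [z] is the second root of the form.
    This and [pf_norm] are Vieta's formulas. *)
Lemma pf_trace : a%:~R * cj z = - b%:~R - a%:~R * z.
Proof.
case: pf => _ _ _ h.
have := congr1 cj h; rewrite conj_sqrtD -h conjcD !conjcM conjc_nat !conjc_int => h2.
apply: (@mulfI _ (2 : C)); first by rewrite pnatr_eq0.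
apply: (@addIr _ b%:~R); rewrite mulrA h2; ring.
Qed.

Lemma pf_norm : a%:~R * (z * cj z) = c%:~R.
Proof.
case: pf => _ _ h _; rewrite mulrCA pf_trace.
by apply/eqP; rewrite -subr_eq0 -oppr_eq0 -h; apply/eqP; ring.
Qed.

Lemma pf_sq : a%:~R * (z * z) = - b%:~R * z - c%:~R.
Proof.
by case: pf => _ _ h _; apply/eqP; rewrite -subr_eq0 -h; apply/eqP; ring.
Qed.

Lemma pf_Im : 0 < complex.Im z.
Proof.
case: pf => a0 _ _ h; have := congr1 (@complex.Im R) h.
rewrite ImD Im_int addr0 (_ : 2 * a%:~R = (2 * a)%:~R); last by ring.
rewrite Im_intM => h2.
have a2 : 0 < (2 * a)%:~R :> R by rewrite ltr0z mulr_gt0.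
by rewrite -(pmulr_rgt0 _ a2) h2 sqrtD_Im // hD.1.
Qed.

Lemma pf_disc : b * b - 4 * a * c = D.
Proof.
apply: (@intr_inj C); rewrite -(sqrtD_sq R hD.1); case: pf => _ _ h <-.
have -> : (2 * a%:~R * z + b%:~R) * (2 * a%:~R * z + b%:~R) =
  4 * a%:~R * (a%:~R * (z * z)) + 4 * a%:~R * b%:~R * z + b%:~R * b%:~R by ring.
by rewrite pf_sq; ring.
Qed.

Lemma pf_omega : exists k : int, a%:~R * z = k%:~R + w.
Proof.
have [t tE] : exists t : int, b * b + b = 2 * t.
  have := divz_eq b 2; have := modz_ge0 b (isT : 2%:Z != 0).
  have := ltz_mod b (isT : 2%:Z != 0).
  set r := (b %% 2)%Z; set q := (b %/ 2)%Z => r1 r0 ->.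
  have : r = 0 \/ r = 1 by lia.
  by case=> ->; [exists (2 * q * q + q)|exists (2 * q * q + 3 * q + 1)]; ring.
(* This is -(b + D)/2 with [D] replaced by [b * b - 4 * a * c]; it is an integer because b^2 + b is
   even. *)
exists (2 * a * c - t).
apply: (@mulfI _ (2 : C)); first by rewrite pnatr_eq0.
rewrite mulrDr omega2; case: pf => _ _ _ <-; rewrite -pf_disc.
have -> : 2 * (2 * a * c - t)%:~R = (4 * a * c - 2 * t)%:~R :> C by ring.
by rewrite -tE; ring.
Qed.

Lemma pf_bezout : exists u v t : int, u * a + v * b + t * c = 1.
Proof.
case: pf => _ g _ _.
have [u [v e]] := Bezoutz (gcdz a b) c; have [u' [v' e']] := Bezoutz a b.
by exists (u * u'), (u * v'), v; rewrite -g -e -e'; ring.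
Qed.

(** Up to an integer [omegaK] is [a * z], which preserves the lattice because a z^2 = -b z - c. *)
Lemma lat_OK r x : O r -> L z x -> L z (r * x).
Proof.
move=> [m [n ->]] [p [q ->]]; have [k ek] := pf_omega.
have -> : w = a%:~R * z - k%:~R by rewrite ek; ring.
exists (m * p - n * k * p - n * q * c), (m * q + n * p * a - n * k * q - n * q * b).
transitivity ((m * p - n * k * p)%:~R + (m * q + n * p * a - n * k * q)%:~R * z
  + (n * q)%:~R * (a%:~R * (z * z))); first by ring.
by rewrite pf_sq; ring.
Qed.

Lemma lat_conj_OK x y : L z x -> L z y -> O (a%:~R * (x * cj y)).
Proof.
move=> [m [n ->]] [p [q ->]]; have [k ek] := pf_omega.
rewrite conjcD conjcM !conjc_int.
have -> : a%:~R * ((m%:~R + n%:~R * z) * (p%:~R + q%:~R * cj z)) =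
  (m * p * a)%:~R + (n * p)%:~R * (a%:~R * z) + (m * q)%:~R * (a%:~R * cj z)
  + (n * q)%:~R * (a%:~R * (z * cj z)) by ring.
rewrite pf_norm pf_trace ek.
exists (m * p * a + n * p * k - m * q * b - m * q * k + n * q * c), (n * p - m * q).
by ring.
Qed.

(** By Vieta, [a], [b] and [c] are combinations of [a] and [a * cj z] with coefficients in
    [Z + Z z]. A Bezout relation thus writes 1 as such a combination, and multiplying it by [x] puts
    [x] in the lattice. *)
Lemma lat_of_conj_OK x : O (x * a%:~R) -> O (x * (a%:~R * cj z)) -> L z x.
Proof.
move=> h1 h2; have [u [v [t /(congr1 (fun x : int => x%:~R : C)) e]]] := pf_bezout.
have hb : b%:~R = - (a%:~R * cj z) - a%:~R * z by rewrite pf_trace; ring.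
have -> : x = (x * a%:~R) * (u%:~R - v%:~R * z)
            + (x * (a%:~R * cj z)) * (- v%:~R + t%:~R * z).
  transitivity (x * (u * a + v * b + t * c)%:~R); first by rewrite e mulr1.
  by rewrite !intrD !intrM hb -pf_norm; ring.
apply: latD; apply: lat_OK => //.
  by exists u, (- v); ring.
by exists (- v), t; ring.
Qed.

Lemma lat_endo : cm_by_OK D z.
Proof.
apply/seteqP; split=> [al h|r hr x]; last exact: lat_OK.
have [m [n alE]] : L z al by rewrite -[al]mulr1; apply: h; exact: (lat_int z 1).
have [p [q e]] := h z (lat_self z).
have [e1 e2] : - (n * c) = a * p /\ a * m - n * b = a * q.
  apply: (lattice_coord pf_Im).
  have <- : a%:~R * (al * z) = (a * p)%:~R + (a * q)%:~R * z by rewrite e; ring.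
  rewrite alE; symmetry.
  transitivity (a%:~R * m%:~R * z + n%:~R * (a%:~R * (z * z))); first by ring.
  by rewrite pf_sq; ring.
(* Stability of the lattice makes [a] divide [n * b] and [n * c], hence [n] by primitivity; then
   [al] is an integer combination of 1 and [a * z]. *)
have [u [v [t e3]]] := pf_bezout; have [k ek] := pf_omega.
have [n' n'E] : exists n', n = n' * a.
  exists (n * u + v * (m - q) - t * p).
  rewrite -[LHS]mulr1 -e3.
  transitivity (n * u * a + v * (n * b) + t * (n * c)); first by ring.
  have -> : n * b = a * m - a * q by lia.
  have -> : n * c = - (a * p) by lia.
  by ring.
exists (m + n' * k), n'.
by rewrite alE n'E intrM -mulrA ek; ring.
Qed.

End PrimitiveForm.

(** [omegaK] acts on the basis [1, z] by an integer matrix, which yields an integral quadratic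
    equation for [z]. Dividing by its content gives the form; the discriminant is [D] because the
    multiplier ring is the full maximal order. *)
Lemma cm_primitive_form z : upper z -> cm_by_OK D z ->
  exists a b c, primitive_form D z a b c.
Proof.
rewrite /upper => zp cm.
have endo : forall al, O al -> forall x, L z x -> L z (al * x).
  by move=> al; rewrite -cm.
have [m [n e1]] : L z (w * 1) by apply: endo; [exact: OK_omega|exact: (lat_int z 1)].
have [m' [n' e2]] := endo _ (OK_omega R D) _ (lat_self z).
rewrite mulr1 in e1.
have n0 : 0 < n.
  have := congr1 (@complex.Im R) e1; rewrite ImD Im_int add0r Im_intM => h.
  have := omega_Im R hD.1; rewrite h pmulr_lgt0// ltr0z//.
(* The content of n z^2 + (m - n') z - m', the equation left after eliminating [omegaK]. *)
set g := gcdz (gcdz n (m - n')) (- m').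
have g0 : 0 < g.
  by rewrite lt_neqAle eq_sym /g gcdz_eq0 gcdz_eq0 (gt_eqF n0).
have /dvdzP[a aE] : (g %| n)%Z.
  by apply: dvdz_trans (dvdz_gcdl _ _) (dvdz_gcdl _ _).
have /dvdzP[b bE] : (g %| m - n')%Z.
  by apply: dvdz_trans (dvdz_gcdl _ _) (dvdz_gcdr _ _).
have /dvdzP[c cE] : (g %| - m')%Z by exact: dvdz_gcdr.
have gne0 : (g%:~R : C) != 0 by rewrite intr_eq0 gt_eqF.
have a0 : 0 < a by rewrite -(pmulr_lgt0 _ g0) -aE.
have eqz : a%:~R * z ^+ 2 + b%:~R * z + c%:~R = 0.
  apply: (mulfI gne0); rewrite mulr0.
  transitivity ((a * g)%:~R * (z * z) + (b * g)%:~R * z + (c * g)%:~R); first by ring.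
  rewrite -aE -bE -cE.
  transitivity ((m%:~R + n%:~R * z) * z - (m'%:~R + n'%:~R * z)); first by ring.
  by rewrite -e1 -e2 subrr.
have prim : gcdz (gcdz a b) c = 1.
  apply: (mulIf (x := g)); first by rewrite gt_eqF.
  have gE : `|g|%N%:Z = g by rewrite gez0_abs// ltW.
  by rewrite mul1r -{1}gE mulz_gcdl -{1}gE mulz_gcdl -aE -bE -cE.
(* [a * z] also preserves the lattice, hence lies in the order; comparison with
   [omegaK = m + g * a * z] then forces [g * n1 = 1]. *)
have [m1 [n1 e3]] : O (a%:~R * z).
  rewrite -cm => x [p [q ->]].
  exists (- q * c), (p * a - q * b).
  transitivity (p%:~R * a%:~R * z + q%:~R * (a%:~R * z ^+ 2)); first by ring.
  have -> : a%:~R * z ^+ 2 = - b%:~R * z - c%:~R.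
    by apply/eqP; rewrite -subr_eq0 -eqz; apply/eqP; ring.
  by ring.
have [_ e4] : 0 = m + g * m1 /\ 1 = g * n1.
  apply: (lattice_coord (omega_Im R hD.1)).
  transitivity (m%:~R + n%:~R * z); first by rewrite -e1; ring.
  transitivity (m%:~R + g%:~R * (a%:~R * z)); first by rewrite aE; ring.
  by rewrite e3; ring.
have n11 : n1 = 1 by nia.
rewrite n11 mul1r in e3.
exists a, b, c; split=> //.
have e5 : 2 * a%:~R * z + b%:~R = (2 * m1 + D + b)%:~R + s.
  by rewrite -mulrA e3 mulrDr omega2; ring.
suff t0 : 2 * m1 + D + b = 0 by rewrite e5 t0 add0r.
have e6 : (2 * a%:~R * z + b%:~R) ^+ 2 = (b * b - 4 * a * c)%:~R.
  transitivity (4 * a%:~R * (a%:~R * z ^+ 2 + b%:~R * z + c%:~R) + (b * b - 4 * a * c)%:~R).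
    by ring.
  by rewrite eqz mulr0 add0r.
rewrite e5 in e6; move: e6; set t := 2 * m1 + D + b => e6.
(* The square of [t + sqrtD] is an integer, so its [sqrtD] coordinate [2 * t] vanishes. *)
suff [_ h] : t * t + D = b * b - 4 * a * c /\ 2 * t = 0 by lia.
apply: (lattice_coord (sqrtD_Im R hD.1)).
by rewrite mul0r addr0 -e6 intrD -(sqrtD_sq R hD.1); ring.
Qed.

End Lattices.

(** * Ideals, their bases and their norms *)

Definition OK_module (R : realType) (D : int) (M : set R[i]) : Prop :=
  [/\ M 0, (forall x y, M x -> M y -> M (x + y)) &
      (forall r x, OK D r -> M x -> M (r * x))].

Definition conj_set (R : realType) (I : set R[i]) : set R[i] := [set conjc x | x in I].

(* [I * conj I = r O], stated elementwise. *)
Definition has_norm (R : realType) (D : int) (I : set R[i]) (r : R[i]) : Prop :=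
  (forall x y, I x -> I y -> exists2 t, OK D t & x * conjc y = r * t) /\
  idmul I (conj_set I) r.

(* For [z] a root of a primitive form with leading coefficient [a], the lattice
   [a * conj (Z + Z z)] is the inverse of the fractional ideal [Z + Z z]. *)
Definition inv_lattice (R : realType) (a : int) (z x : R[i]) : set R[i] :=
  [set x * (a%:~R * conjc y) | y in lattice_tau z].

Section Ideals.
Variables (R : realType) (D : int) (hD : neg_fund_disc D).
Local Notation C := R[i].
Local Notation cj := (@conjc R).
Local Notation L := (@lattice_tau R).
Local Notation w := (omegaK R D).
Local Notation s := (sqrtD R D).
Local Notation O := (@OK R D).
Implicit Types I J M q : set C.

Lemma idmul_mem I J x y : I x -> J y -> idmul I J (x * y).
Proof.
move=> Ix Jy; exists [:: (x, y)]; split; last by rewrite big_seq1.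
by move=> p [<-|[]].
Qed.

Lemma idmul_ind I J (P : C -> Prop) : P 0 ->
  (forall x y, P x -> P y -> P (x + y)) ->
  (forall x y, I x -> J y -> P (x * y)) -> forall z, idmul I J z -> P z.
Proof.
move=> P0 PD PM z [l [hl ->]]; elim: l hl => [|p l IH] hl; first by rewrite big_nil.
rewrite big_cons; apply: PD; last by apply: IH => p' h; apply: hl; right.
by have [h1 h2] := hl p (or_introl erefl); apply: PM.
Qed.

Lemma idmul0 I J : idmul I J 0.
Proof. by exists [::]; split => //; rewrite big_nil. Qed.

Lemma idmulD I J x y : idmul I J x -> idmul I J y -> idmul I J (x + y).
Proof.
move=> [l [hl ->]] [l' [hl' ->]]; exists (l ++ l'); split; last by rewrite big_cat.
by move=> p h; case: (List.in_app_or _ _ _ h); [exact: hl|exact: hl'].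
Qed.

Lemma idmulC I J : idmul I J = idmul J I.
Proof.
by apply/seteqP; split=> z; apply: idmul_ind => [||x y Ix Jy];
  rewrite ?(mulrC x); first [exact: idmul0|exact: idmulD|exact: idmul_mem].
Qed.

Lemma ideal_module I : is_ideal D I -> OK_module D I.
Proof. by case. Qed.

Lemma moduleN M x : OK_module D M -> M x -> M (- x).
Proof.
by move=> [_ _ h] Mx; rewrite -mulN1r; apply: h => //; apply: OKN; exact: OK1.
Qed.

Lemma moduleB M x y : OK_module D M -> M x -> M y -> M (x - y).
Proof. by move=> hM Mx My; case: (hM) => _ h _; apply: h => //; exact: moduleN. Qed.

Lemma idmul_module I M : OK_module D M -> OK_module D (idmul I M).
Proof.
move=> [M0 MD MZ]; split; [exact: idmul0|exact: idmulD|move=> r x hr].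
move: x; apply: idmul_ind => [|y z|y z Iy Mz]; first by rewrite mulr0; exact: idmul0.
  by rewrite mulrDr; exact: idmulD.
by rewrite mulrCA; apply: idmul_mem => //; exact: MZ.
Qed.

Lemma idmul_sub_module I M z : (forall x, I x -> O x) -> OK_module D M ->
  idmul I M z -> M z.
Proof.
by move=> IO [M0 MD MZ]; apply: idmul_ind => // x y Ix My; apply: MZ => //; exact: IO.
Qed.

Lemma idmul_ideal I J : is_ideal D I -> is_ideal D J -> is_ideal D (idmul I J).
Proof.
move=> hI hJ; have mJ := ideal_module hJ; have [? ? ?] := idmul_module I mJ.
case: (hI) => IO _ _ _ [x [Ix x0]]; case: (hJ) => JO _ _ _ [y [Jy y0]].
split=> //; last by exists (x * y); split; [exact: idmul_mem|rewrite mulf_neq0].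
by move=> z h; apply: JO; apply: idmul_sub_module h.
Qed.

Lemma OK_ideal : is_ideal D O.
Proof.
split=> //; [exact: OK0|exact: OKD|by move=> *; exact: OKM|].
by exists 1; split; [exact: OK1|rewrite oner_eq0].
Qed.

Lemma idmul_OKl I : OK_module D I -> idmul O I = I.
Proof.
move=> hI; apply/seteqP; split=> z; first exact: idmul_sub_module.
by move=> Iz; rewrite -[z]mul1r; apply: idmul_mem => //; exact: OK1.
Qed.

Lemma conj_ideal I : is_ideal D I -> is_ideal D (conj_set I).
Proof.
move=> [IO I0 ID IZ [x [Ix x0]]]; split.
- by move=> _ [y Iy <-]; apply: OK_conj; exact: IO.
- by exists 0 => //; rewrite conjc0.
- by move=> _ _ [y Iy <-] [t It <-]; exists (y + t); [exact: ID|exact: conjcD].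
- move=> r _ hr [y Iy <-]; exists (cj r * y); last by rewrite conjcM conjcK.
  by apply: IZ => //; exact: OK_conj.
- by exists (cj x); split; [exists x|rewrite conjc_eq0].
Qed.

Lemma conj_setK I : conj_set (conj_set I) = I.
Proof.
apply/seteqP; split=> [_ [_ [y Iy <-] <-]|y Iy]; first by rewrite conjcK.
by exists (cj y); [exists y|rewrite conjcK].
Qed.

(** This is a Hermite normal form: [n0] is the least positive integer in [I] and [g] the least
    positive coefficient of [omegaK]. Stability under the order makes [g] divide both [n0] and [k0],
    and the quotient lattice belongs to a form of discriminant [D]. *)
Lemma ideal_basis I : is_ideal D I -> exists g a k c : int,
  [/\ 0 < g, 0 < a, primitive_form D ((k%:~R + w) / a%:~R) a (- (2 * k + D)) c &
   I = [set x | exists p q : int, x = g%:~R * (p%:~R * a%:~R + q%:~R * (k%:~R + w))]].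
Proof.
move=> hI; have mI := ideal_module hI; case: (hI) => IO I0 ID IZ [x [Ix x0]].
have IZz (n : int) y : I y -> I (n%:~R * y) by apply: IZ; exact: OK_int.
(* Up to sign, the norm of a nonzero element is such an integer. *)
have exn : exists n : nat, (0 < n)%N && `[< I n%:R >].
  have Ixx : I (cj x * x) by apply: IZ => //; apply: OK_conj; exact: IO.
  have [|m mE] := OK_real hD.1 (IO _ Ixx); first by rewrite conjcM conjcK mulrC.
  have m0 : m != 0 by rewrite -(intr_eq0 C) -mE mulf_neq0// conjc_eq0.
  exists `|m|%N; rewrite absz_gt0 m0; apply/asboolP.
  rewrite -[_%:R]/(`|m|%N%:Z%:~R); case: (lerP 0 m) => m1.
    by rewrite gez0_abs// -mE.
  by rewrite ltz0_abs// rmorphN /= -mE; exact: moduleN.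
have exg : exists n : nat, (0 < n)%N && `[< exists m : int, I (m%:~R + n%:R * w) >].
  case: exn => n /andP[n0 /asboolP In]; exists n; rewrite n0; apply/asboolP.
  by exists 0; rewrite add0r mulrC; apply: IZ => //; exact: OK_omega.
case: (ex_minnP exn) => n0 /andP[n0p /asboolP In0] n0min.
case: (ex_minnP exg) => g /andP[gp /asboolP[k0 Ik0]] gmin {exn exg}.
have gne : (g%:Z : int) != 0 by rewrite -lt0n in gp *; lia.
have nne : (n0%:Z : int) != 0 by rewrite -lt0n in n0p *; lia.
have divg (m n : int) : I (m%:~R + n%:~R * w) -> exists q : int, n = q * g%:Z.
  move=> Imn; exists (n %/ g%:Z)%Z.
  have nE := divz_eq n g%:Z; have r0 := modz_ge0 n gne; have r1 := ltz_mod n gne.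
  rewrite [LHS]nE; move: nE r0 r1; set r := (n %% _)%Z; set q := (n %/ _)%Z => nE r0 r1.
  have [->|rne] := eqVneq r 0; first by rewrite addr0.
  suff : (g <= `|r|)%N by lia.
  apply: gmin; apply/andP; split; first by rewrite absz_gt0.
  apply/asboolP; exists (m - q * k0).
  have -> : (m - q * k0)%:~R + `|r|%N%:R * w =
      (m%:~R + n%:~R * w) - q%:~R * (k0%:~R + g%:R * w).
    rewrite -[ `|r|%N%:R]/(`|r|%N%:Z%:~R) gez0_abs// nE -[g%:R]/(g%:Z%:~R); ring.
  by apply: moduleB => //; exact: IZz.
have divn (m : int) : I m%:~R -> exists q : int, m = q * n0%:Z.
  move=> Im; exists (m %/ n0%:Z)%Z.
  have mE := divz_eq m n0%:Z; have r0 := modz_ge0 m nne; have r1 := ltz_mod m nne.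
  rewrite [LHS]mE; move: mE r0 r1; set r := (m %% _)%Z; set q := (m %/ _)%Z => mE r0 r1.
  have [->|rne] := eqVneq r 0; first by rewrite addr0.
  suff : (n0 <= `|r|)%N by lia.
  apply: n0min; apply/andP; split; first by rewrite absz_gt0.
  apply/asboolP.
  have -> : (`|r|%N%:R : C) = m%:~R - q%:~R * n0%:R.
    rewrite -[ `|r|%N%:R]/(`|r|%N%:Z%:~R) gez0_abs// mE -[n0%:R]/(n0%:Z%:~R); ring.
  by apply: moduleB => //; exact: IZz.
have [E hE] := disc_mod4 hD; have ww := omega_sq R hD.1 hE.
have [a aE] : exists a : int, n0%:Z = a * g%:Z.
  by apply: (divg 0); rewrite add0r mulrC; apply: IZ => //; exact: OK_omega.
have [k kE] : exists k : int, k0 = k * g%:Z.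
  have [] := divg (- (g%:Z * E)) (k0 + g%:Z * D).
    have -> : (- (g%:Z * E))%:~R + (k0 + g%:Z * D)%:~R * w = w * (k0%:~R + g%:R * w).
      transitivity (k0%:~R * w + g%:Z%:~R * (w * w)); first by rewrite ww; ring.
      by rewrite -[g%:R]/(g%:Z%:~R); ring.
    by apply: IZ => //; exact: OK_omega.
  by move=> t te; exists (t - D); rewrite mulrBl -te; ring.
have a0 : 0 < a by move: n0p gp aE; nia.
(* Multiplying [k0 + g * omegaK] by the conjugate of [k + omegaK] gives an integer of the ideal, [g]
   times a norm, which [n0] must divide. *)
have [c cE] : exists c : int, g%:Z * (k * k + k * D + E) = c * n0%:Z.
  apply: divn.
  have -> : (g%:Z * (k * k + k * D + E))%:~R = (k%:~R + cj w) * (k0%:~R + g%:R * w).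
    rewrite kE conj_omega -[g%:R]/(g%:Z%:~R).
    transitivity (g%:Z%:~R * (k%:~R * k%:~R + k%:~R * D%:~R + D%:~R * w - w * w) : C).
      by rewrite ww; ring.
    by ring.
  by apply: IZ => //; apply: OKD; [exact: OK_int|apply: OK_conj; exact: OK_omega].
exists g%:Z, a, k, c; split=> //.
  apply: (pf_make R hD hE) => //; apply: (mulfI gne); rewrite cE aE; ring.
apply/seteqP; split=> [y Iy|y [p [q ->]]].
  have [m [n yE]] := IO _ Iy.
  have [q qE] : exists q : int, n = q * g%:Z by apply: (divg m); rewrite -yE.
  have [p pE] : exists p : int, m - q * k0 = p * n0%:Z.
    apply: divn.
    have -> : (m - q * k0)%:~R = y - q%:~R * (k0%:~R + g%:R * w).
      rewrite yE qE -[g%:R]/(g%:Z%:~R); ring.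
    by apply: moduleB => //; exact: IZz.
  exists p, q; rewrite yE qE.
  have -> : m = p * a * g%:Z + q * k0 by rewrite -mulrA -aE -pE; ring.
  by rewrite kE; ring.
have -> : g%:Z%:~R * (p%:~R * a%:~R + q%:~R * (k%:~R + w)) =
  p%:~R * n0%:R + q%:~R * (k0%:~R + g%:R * w).
  rewrite kE -[n0%:R]/(n0%:Z%:~R) aE -[g%:R]/(g%:Z%:~R); ring.
by apply: ID; apply: IZz.
Qed.

Lemma has_norm_sub I r v : has_norm D I r -> idmul I (conj_set I) v ->
  exists2 t, O t & v = r * t.
Proof.
move=> [h _]; move: v; apply: idmul_ind.
- by exists 0; rewrite ?mulr0//; exact: OK0.
- move=> _ _ [t Ot ->] [t' Ot' ->]; exists (t + t'); first exact: OKD.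
  by rewrite mulrDr.
- by move=> x _ Ix [y Iy <-]; exact: h.
Qed.

(** The quotients of [r] and [r'] by each other are positive reals in the order, hence positive
    integers with product 1. *)
Lemma has_norm_uniq I r r' : 0 < r -> 0 < r' ->
  has_norm D I r -> has_norm D I r' -> r = r'.
Proof.
move=> r0 r0' h h'.
have [t Ot e] := has_norm_sub h' h.2; have [t' Ot' e'] := has_norm_sub h h'.2.
have real u : 0 < u -> cj u = u.
  by move=> u0; rewrite -[cj u]/(Num.conj u); apply/CrealP; exact: gtr0_real.
have cr (u v x : C) : 0 < u -> 0 < v -> u = v * x -> cj x = x /\ 0 < x.
  move=> u0 v0 uE; have v1 : v != 0 by rewrite gt_eqF.
  have xE : x = u / v by rewrite uE mulrC mulKf.
  have x0 : 0 < x by rewrite xE divr_gt0.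
  by split=> //; exact: real.
have [rt t0] := cr _ _ _ r0 r0' e; have [rt' t0'] := cr _ _ _ r0' r0 e'.
have [m mE] := OK_real hD.1 Ot rt; have [m' mE'] := OK_real hD.1 Ot' rt'.
move: t0 t0'; rewrite mE mE' !ltr0z => m0 m0'.
have : m * m' = 1.
  apply: (@intr_inj C); rewrite intrM -mE -mE'.
  have r1 : r != 0 by rewrite gt_eqF.
  by apply: (mulfI r1); rewrite mulr1 [in RHS]e e'; ring.
move=> mm; have m1 : m = 1 by nia.
by rewrite e mE m1 mulr1.
Qed.

Lemma has_normM I J r t : has_norm D I r -> has_norm D J t ->
  has_norm D (idmul I J) (r * t).
Proof.
move=> [h1 h2] [h3 h4]; split.
  move=> x y hx hy; move: x hx; apply: idmul_ind.
  - by exists 0; rewrite ?mul0r ?mulr0//; exact: OK0.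
  - move=> x x' [u Ou e] [u' Ou' e']; exists (u + u'); first exact: OKD.
    by rewrite mulrDl e e' mulrDr.
  move=> x x' Ix Jx'; move: y hy; apply: idmul_ind.
  - by exists 0; rewrite ?conjc0 ?mulr0//; exact: OK0.
  - move=> y y' [u Ou e] [u' Ou' e']; exists (u + u'); first exact: OKD.
    by rewrite conjcD mulrDr e e' mulrDr.
  move=> y y' Iy Jy'.
  have [u Ou e] := h1 _ _ Ix Iy; have [u' Ou' e'] := h3 _ _ Jx' Jy'.
  exists (u * u'); first exact: OKM.
  by rewrite conjcM mulrACA e e' mulrACA.
move: r h2 {h1}; apply: idmul_ind.
- by rewrite mul0r; exact: idmul0.
- by move=> x y hx hy; rewrite mulrDl; exact: idmulD.
move=> x _ Ix [x' Ix' <-]; move: t h4 {h3}; apply: idmul_ind.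
- by rewrite mulr0; exact: idmul0.
- by move=> y y' hy hy'; rewrite mulrDr; exact: idmulD.
move=> y _ Jy [y' Jy' <-]; rewrite mulrACA -conjcM; apply: idmul_mem.
  exact: idmul_mem.
by exists (x' * y') => //; exact: idmul_mem.
Qed.

Lemma has_norm_conj I r : cj r = r -> has_norm D I r -> has_norm D (conj_set I) r.
Proof.
move=> rr [h1 h2]; split; last by rewrite conj_setK idmulC.
move=> _ _ [x Ix <-] [y Iy <-]; have [t Ot e] := h1 _ _ Ix Iy.
by exists (cj t); [exact: OK_conj|rewrite -conjcM e conjcM rr].
Qed.

(** With the factor |x|^2 / a taken out, products of lattice elements with conjugates yield [a], [b]
    and [c] as sums; a Bezout relation between these gives 1. *)
Lemma has_norm_lattice z a b c x : primitive_form D z a b c ->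
  has_norm D [set x * y | y in L z] (x * cj x / a%:~R).
Proof.
move=> pf; have a0 := pf_a0 pf; split.
  move=> _ _ [y Ly <-] [y' Ly' <-]; exists (a%:~R * (y * cj y')).
    exact: lat_conj_OK pf _ _ _ _.
  by rewrite conjcM; field.
have [u [v [t /(congr1 (fun x : int => x%:~R : C)) e]]] := pf_bezout pf.
have hb : b%:~R = - (a%:~R * cj z) - a%:~R * z by rewrite (pf_trace pf); ring.
have hc : c%:~R = a%:~R * (z * cj z) by rewrite (pf_norm pf).
have -> : x * cj x / a%:~R = (x * (u%:~R - v%:~R * z)) * cj (x * 1)
                   + (x * (- v%:~R + t%:~R * z)) * cj (x * z).
  transitivity (x * cj x / a%:~R * (u * a + v * b + t * c)%:~R).
    by rewrite e mulr1.
  by rewrite !intrD !intrM hb hc !conjcM conjc1; field.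
apply: idmulD; apply: idmul_mem.
- by exists (u%:~R - v%:~R * z) => //; exists u, (- v); ring.
- by exists (x * 1) => //; exists 1 => //; exact: (lat_int z 1).
- by exists (- v%:~R + t%:~R * z) => //; exists (- v), t; ring.
- by exists (x * z) => //; exists z => //; exact: lat_self.
Qed.

Lemma residue_uniq (t g r r' : int) : 0 <= r -> r < g -> 0 <= r' -> r' < g ->
  t * g + (r - r') = 0 -> r = r'.
Proof.
move=> h1 h2 h3 h4 h; have [t0|t0|t0] := ltgtP t 0; last by move: h; rewrite t0; lia.
  have : t * g <= (- 1) * g by apply: ler_wpM2r; lia.
  by lia.
have : 1 * g <= t * g by apply: ler_wpM2r; lia.
by lia.
Qed.

Lemma idnorm_basis (g a : nat) (k : int) : (0 < g)%N -> (0 < a)%N ->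
  idnorm D [set x : C | exists p q : int,
    x = g%:R * (p%:~R * a%:R + q%:~R * (k%:~R + w))] (g * a * g)%N.
Proof.
move=> g0 a0.
(* The residues i + j [omegaK] with i < g a and j < g, encoded as quotient and remainder of one
   index by [g]. *)
exists (fun i : 'I_(g * a * g) => (i %/ g)%N%:R + (i %% g)%N%:R * w); split.
  by move=> i; exists (i %/ g)%N%:Z, (i %% g)%N%:Z.
have gne : (g%:Z : int) != 0 by lia.
have gane : ((g * a)%N%:Z : int) != 0 by lia.
have inI (m n : int) : (exists p q : int,
      m%:~R + n%:~R * w = g%:R * (p%:~R * a%:R + q%:~R * (k%:~R + w))) <->
    exists p q : int, n = q * g%:Z /\ m - k * n = p * (g * a)%N%:Z.
  split=> [[p [q e]]|[p [q [nE mE]]]]; exists p, q.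
    have [mE nE] : m = g%:Z * (p * a%:Z + q * k) /\ n = g%:Z * q.
      apply: (lattice_coord (omega_Im R hD.1)); rewrite e.
      by rewrite -[g%:R]/(g%:Z%:~R) -[a%:R]/(a%:Z%:~R); ring.
    by rewrite mE nE PoszM; split; ring.
  have -> : m = p * (g * a)%N%:Z + k * n by rewrite -mE; ring.
  by rewrite nE -[g%:R]/(g%:Z%:~R) -[a%:R]/(a%:Z%:~R) PoszM; ring.
move=> x [m [n ->]].
have n0 := modz_ge0 n gne; have n1 := ltz_mod n gne; have nE := divz_eq n g%:Z.
move: n0 n1 nE; set n2 := (n %% _)%Z; set nq := (n %/ _)%Z => n0 n1 nE.
(* Reducing the coefficient of [omegaK] from [n] to [n2] subtracts a multiple of g (k + [omegaK]),
   which moves the integer part by [k * (n - n2)]. *)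
set m' := m - k * (n - n2).
have m0 := modz_ge0 m' gane; have m1 := ltz_mod m' gane; have mE := divz_eq m' (g * a)%N%:Z.
move: m0 m1 mE; set m2 := (m' %% _)%Z; set mq := (m' %/ _)%Z => m0 m1 mE.
have lt : (`|m2| * g + `|n2| < g * a * g)%N by nia.
have dE : ((`|m2| * g + `|n2|) %/ g)%N = `|m2|%N.
  by rewrite divnMDl// divn_small ?addn0//; lia.
have rE : ((`|m2| * g + `|n2|) %% g)%N = `|n2|%N.
  by rewrite modnMDl modn_small//; lia.
have diff (i : nat) : m%:~R + n%:~R * w - ((i %/ g)%N%:R + (i %% g)%N%:R * w) =
   (m - (i %/ g)%N%:Z)%:~R + (n - (i %% g)%N%:Z)%:~R * w :> C.
  by rewrite !intrD !rmorphN /= !pmulrn; ring.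
exists (Ordinal lt); split=> /=.
  rewrite diff; apply/inI; rewrite dE rE !gez0_abs//; exists mq, nq.
  split; first by rewrite nE; ring.
  by move: mE; rewrite /m'; lia.
move=> i; rewrite diff => /inI[p [q [e1 e2]]]; apply/val_inj => /=.
have ir : (i %% g < g)%N by rewrite ltn_mod.
have iq : (i %/ g < g * a)%N by rewrite ltn_divLR.
have r2 : n2 = (i %% g)%N%:Z.
  apply: (@residue_uniq (nq - q) g%:Z) => //.
  by rewrite mulrBl -e1 nE; ring.
have q2 : m2 = (i %/ g)%N%:Z.
  apply: (@residue_uniq (mq - p) (g * a)%N%:Z) => //.
  have -> : (mq - p) * (g * a)%N%:Z + (m2 - (i %/ g)%N%:Z) =
    m' - m2 - p * (g * a)%N%:Z + (m2 - (i %/ g)%N%:Z) by rewrite mE; ring.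
  by rewrite -e2 -r2 /m'; ring.
by rewrite r2 q2 !absz_nat -divn_eq.
Qed.

(** This ties the count of residues to the product with the conjugate ideal: both norms are read off
    one basis and equal g^2 a. *)
Lemma idnorm_exists I : is_ideal D I ->
  exists n : nat, [/\ (0 < n)%N, idnorm D I n & has_norm D I n%:R].
Proof.
move=> hI; have [g [a [k [c [g0 a0 pf IE]]]]] := ideal_basis hI.
exists (`|g| * `|a| * `|g|)%N; split; first by rewrite !muln_gt0 !absz_gt0 !gt_eqF.
  rewrite IE -{1}(gez0_abs (ltW g0)) -{1}(gez0_abs (ltW a0)).
  by apply: idnorm_basis; rewrite absz_gt0 gt_eqF.
have ane := pf_a0 pf.
have := has_norm_lattice (g%:~R * a%:~R) pf.
have -> : [set g%:~R * a%:~R * y | y in L ((k%:~R + w) / a%:~R)] = I.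
  rewrite IE; apply/seteqP; split=> [_ [_ [p [q ->]] <-]|_ [p [q ->]]].
    by exists p, q; field.
  by exists (p%:~R + q%:~R * ((k%:~R + w) / a%:~R)); [exists p, q|field].
suff -> : g%:~R * a%:~R * cj (g%:~R * a%:~R) / a%:~R = (`|g| * `|a| * `|g|)%N%:R :> C by [].
rewrite -[RHS]/((`|g| * `|a| * `|g|)%N%:Z%:~R) !PoszM !gez0_abs ?ltW//.
by rewrite conjcM !conjc_int; field.
Qed.

Lemma idnorm_uniq I m n : OK_module D I -> idnorm D I m -> idnorm D I n -> m = n.
Proof.
move=> mI; wlog suff hle : m n / idnorm D I m -> idnorm D I n -> (m <= n)%N.
  by move=> h1 h2; apply/eqP; rewrite eqn_leq !hle.
move=> [r [rO rU]] [r' [rO' rU']].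
have [f fP] : {f : 'I_m -> 'I_n & forall k, I (r k - r' (f k))}.
  by apply: (@choice _ _ (fun k j => I (r k - r' j))) => k; have [j [hj _]] := rU' _ (rO k); exists j.
rewrite -(card_ord m) -(card_ord n); apply: (@leq_card _ _ f) => k1 k2 e.
have [k [_ ku]] := rU _ (rO' (f k1)).
rewrite -(ku k1) ?(ku k2)//.
  by rewrite -opprB; apply: moduleN => //; rewrite e.
by rewrite -opprB; apply: moduleN.
Qed.

Lemma idnormP I n : is_ideal D I -> idnorm D I n <-> (0 < n)%N /\ has_norm D I n%:R.
Proof.
move=> hI; have [m [m0 h1 h2]] := idnorm_exists hI; split.
  by move=> h; rewrite -(idnorm_uniq (ideal_module hI) h1 h).
move=> [n0 h]; have /eqP : m%:R = n%:R :> C by apply: has_norm_uniq h2 h; rewrite ltr0n.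
by rewrite eqr_nat => /eqP <-.
Qed.

(** Multiplying by the conjugate of [q] turns [q M] into [N M], and the positive integer [N] can be
    divided out. *)
Lemma ideal_cancel q M y : is_ideal D q -> OK_module D M ->
  (forall t, q t -> idmul q M (t * y)) -> M y.
Proof.
move=> hq hM h; case: (hM) => M0 MD MZ.
have [N [N0 _ hN]] := idnorm_exists hq.
have Nne : (N%:R : C) != 0 by rewrite pnatr_eq0 -lt0n.
have key1 t v : q t -> idmul q M v -> exists2 m, M m & cj t * v = N%:R * m.
  move=> qt; move: v; apply: idmul_ind.
  - by exists 0 => //; rewrite !mulr0.
  - move=> x x' [m Mm e] [m' Mm' e']; exists (m + m'); first exact: MD.
    by rewrite !mulrDr e e'.
  move=> x m qx Mm; have [u Ou e] := hN.1 _ _ qx qt.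
  by exists (u * m); [exact: MZ|rewrite !mulrA -e; ring].
have key2 v : idmul q (conj_set q) v -> exists2 m, M m & v * y = N%:R * m.
  move: v; apply: idmul_ind.
  - by exists 0 => //; rewrite mulr0 mul0r.
  - move=> x x' [m Mm e] [m' Mm' e']; exists (m + m'); first exact: MD.
    by rewrite mulrDl mulrDr e e'.
  move=> x _ qx [x' qx' <-]; have [m Mm e] := key1 _ _ qx' (h _ qx).
  by exists m => //; rewrite -e; ring.
have [m Mm] := key2 _ hN.2.
by move/(mulfI Nne) => ->.
Qed.

End Ideals.

(** * Ideals as multiples of inverse lattices, and ideal classes *)

Section Classes.
Variables (R : realType) (D : int) (hD : neg_fund_disc D).
Local Notation C := R[i].
Local Notation cj := (@conjc R).
Local Notation L := (@lattice_tau R).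
Local Notation O := (@OK R D).
Implicit Types I J M q : set C.

Definition OK_unit (u : C) : Prop := [/\ u != 0, O u & O u^-1].

Section InverseLattice.
Variables (z : C) (a b c : int).
Hypothesis pf : primitive_form D z a b c.

Lemma inv_lattice_conj x :
  inv_lattice a z x = conj_set [set (cj x * a%:~R) * y | y in L z].
Proof.
apply/seteqP; split=> [_ [y Ly <-]|_ [_ [y Ly <-] <-]].
  exists (cj x * a%:~R * y); first by exists y.
  by rewrite !conjcM conjcK conjc_int; ring.
by exists y => //; rewrite !conjcM conjcK conjc_int; ring.
Qed.

Lemma inv_lattice_module x : OK_module D (inv_lattice a z x).
Proof.
split.
- by exists 0; [exact: (lat_int z 0)|rewrite conjc0 !mulr0].
- move=> _ _ [y Ly <-] [y' Ly' <-]; exists (y + y'); first exact: latD.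
  by rewrite conjcD; ring.
- move=> r _ hr [y Ly <-]; exists (cj r * y).
    by apply: (lat_OK hD pf) => //; exact: OK_conj.
  by rewrite conjcM conjcK; ring.
Qed.

Lemma inv_lattice_ideal x : x != 0 -> L z x -> is_ideal D (inv_lattice a z x).
Proof.
move=> x0 Lx; have [? ? ?] := inv_lattice_module x; split=> //.
  by move=> _ [y Ly <-]; rewrite mulrCA; apply: (lat_conj_OK hD pf).
exists (x * a%:~R); split; last by rewrite mulf_neq0// (pf_a0 pf).
by exists 1; [exact: (lat_int z 1)|rewrite conjc1 mulr1].
Qed.

Lemma inv_lattice_norm x : has_norm D (inv_lattice a z x) (a%:~R * (x * cj x)).
Proof.
have a0 := pf_a0 pf; rewrite inv_lattice_conj; apply: has_norm_conj.
  by rewrite !conjcM conjcK conjc_int; ring.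
have := has_norm_lattice hD (cj x * a%:~R) pf.
by rewrite conjcM conjcK conjc_int; congr has_norm; field.
Qed.

Lemma inv_lattice_mem x : inv_lattice a z x `<=` O -> L z x.
Proof.
move=> h; apply: (lat_of_conj_OK hD pf); apply: h.
  by exists 1; [exact: (lat_int z 1)|rewrite conjc1 mulr1].
by exists z => //; exact: lat_self.
Qed.

Lemma inv_lattice_scale s x :
  [set s * v | v in inv_lattice a z x] = inv_lattice a z (s * x).
Proof.
apply/seteqP; split=> [_ [_ [y Ly <-] <-]|_ [y Ly <-]].
  by exists y => //; rewrite mulrA.
by exists (x * (a%:~R * cj y)); [exists y|rewrite mulrA].
Qed.

(** After conjugation the inclusion says that [cj u] preserves [Z + Z z], whose multiplier ring is
    the order. *)
Lemma inv_lattice_stab u x : x != 0 ->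
  inv_lattice a z (u * x) `<=` inv_lattice a z x -> O u.
Proof.
move=> x0 h; rewrite -[u]conjcK; apply: OK_conj.
rewrite -(lat_endo hD pf) => y Ly.
have [|y' Ly' e] := h (u * x * (a%:~R * cj y)); first by exists y.
have xa : x * a%:~R != 0 by rewrite mulf_neq0// (pf_a0 pf).
have -> : cj u * y = y' => //.
apply: (can_inj (@conjcK R)); rewrite conjcM conjcK.
by apply: (mulfI xa); rewrite -!mulrA e; ring.
Qed.

(** The points giving one ideal thus form a single orbit of the units; this is the multiplicity
    between sums over points and sums over ideals. *)
Lemma inv_lattice_units x x' : x != 0 -> x' != 0 ->
  inv_lattice a z x = inv_lattice a z x' <-> OK_unit (x' / x).
Proof.
move=> x0 x0'; split=> [e|[u0 Ou Ou']].
  split; first by rewrite mulf_neq0// invr_eq0.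
    by apply: (@inv_lattice_stab _ x) => //; rewrite divfK// e.
  by apply: (@inv_lattice_stab _ x') => //; rewrite invf_div divfK// e.
have sub r t : O r -> inv_lattice a z (r * t) `<=` inv_lattice a z t.
  move=> Or _ [y Ly <-]; exists (cj r * y); last by rewrite conjcM conjcK; ring.
  by apply: (lat_OK hD pf) => //; exact: OK_conj.
apply/seteqP; split.
  by have := sub _ x' Ou'; rewrite invf_div divfK.
by have := sub _ x Ou; rewrite divfK.
Qed.

End InverseLattice.

Section Representatives.
Variables (zs : seq C) (hz : cm_reps D zs).

Lemma cm_reps_uniq : uniq zs.
Proof.
case: hz => _ h _; apply/(uniqP 0) => i j hi hj e; apply: h => //.
rewrite e; exists 1; split; first by rewrite oner_eq0.
apply/seteqP; split=> [y Ly|_ [y Ly <-]]; last by rewrite mul1r.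
by exists y => //; rewrite mul1r.
Qed.

Lemma cm_reps_form z : z \in zs -> exists a b c, primitive_form D z a b c.
Proof. by case: hz => h _ _ /h[] /cm_primitive_form h1 /h1; exact. Qed.

(** The basis is taken for the conjugate of [J] since [inv_lattice] involves conjugation. Its
    lattice has multiplier ring the order, so it is homothetic to that of a representative. *)
Lemma ideal_class J : is_ideal D J -> exists2 z, z \in zs &
  forall a b c, primitive_form D z a b c ->
  exists x, [/\ x != 0, L z x & J = inv_lattice a z x].
Proof.
move=> hJ; have [g [a' [k [c' [g0 a0' pf' JE]]]]] := ideal_basis hD (conj_ideal hJ).
case: hz => _ _ /(_ _ (pf_Im hD pf') (lat_endo hD pf'))[z zin [l [l0 zE]]].
exists z => // a b c pf; have a0 := pf_a0 pf; have a'0 := pf_a0 pf'.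
have g0' : (g%:~R : C) != 0 by rewrite intr_eq0 gt_eqF.
(* Chosen so that [cj x * a] is the total homothety factor g a' / l. *)
set x := cj (g%:~R * a'%:~R / l) / a%:~R.
have x0 : x != 0.
  by rewrite mulf_neq0 ?invr_eq0// conjc_eq0 !mulf_neq0// invr_eq0.
have JE' : J = inv_lattice a z x.
  rewrite inv_lattice_conj -[LHS]conj_setK JE; congr conj_set.
  have -> : cj x * a%:~R = g%:~R * a'%:~R / l.
    by rewrite /x conjcM conjcK conjc_inv conjc_int divfK.
  rewrite zE; apply/seteqP; split=> [_ [p [q ->]]|_ [_ [_ [p [q ->]] <-] <-]].
    exists (l * (p%:~R + q%:~R * ((k%:~R + omegaK R D) / a'%:~R))); last by field; rewrite ?a'0 ?l0.
    by exists (p%:~R + q%:~R * ((k%:~R + omegaK R D) / a'%:~R)) => //; exists p, q.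
  by exists p, q; field; rewrite ?a'0 ?l0.
exists x; split=> //; apply: (inv_lattice_mem pf).
by rewrite -JE'; case: hJ.
Qed.

Lemma ideal_class_uniq z z' a b c a' b' c' x x' :
  z \in zs -> z' \in zs -> primitive_form D z a b c -> primitive_form D z' a' b' c' ->
  x != 0 -> x' != 0 -> inv_lattice a z x = inv_lattice a' z' x' -> z = z'.
Proof.
move=> zin zin' pf pf' x0 x0' e; case: hz => _ h _.
rewrite -(nth_index 0 zin) -(nth_index 0 zin'); congr nth.
apply: h; rewrite ?index_mem// !nth_index//.
have a0 := pf_a0 pf; have a0' := pf_a0 pf'.
have xa : cj x * a%:~R != 0 by rewrite mulf_neq0// conjc_eq0.
have xa' : cj x' * a'%:~R != 0 by rewrite mulf_neq0// conjc_eq0.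
have {}e : [set (cj x * a%:~R) * y | y in L z] = [set (cj x' * a'%:~R) * y | y in L z'].
  rewrite -[LHS]conj_setK -[RHS]conj_setK.
  by rewrite -!inv_lattice_conj e.
exists ((cj x * a%:~R) / (cj x' * a'%:~R)); split.
  by rewrite mulf_neq0// invr_eq0.
apply/seteqP; split=> [y Ly|_ [y Ly <-]].
  have : [set (cj x * a%:~R) * y | y in L z] (cj x' * a'%:~R * y) by rewrite e; exists y.
  by move=> [y' Ly' e']; exists y' => //; rewrite mulrAC e' mulrAC divff// mul1r.
have : [set (cj x' * a'%:~R) * y | y in L z'] (cj x * a%:~R * y) by rewrite -e; exists y.
by move=> [y' Ly' e']; rewrite mulrAC -e' mulrAC divff// mul1r.
Qed.

End Representatives.
End Classes.

(** * Values of a Hecke character along a coset *)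

Section HeckeShift.
Variables (R : realType) (D : int) (hD : neg_fund_disc D).
Local Notation C := R[i].
Local Notation cj := (@conjc R).
Local Notation L := (@lattice_tau R).
Local Notation O := (@OK R D).
Implicit Types I J M q : set C.

Lemma idmul_scale (s : C) I J :
  idmul [set s * i | i in I] J = [set s * v | v in idmul I J].
Proof.
apply/seteqP; split=> v.
  move: v; apply: idmul_ind.
  - by exists 0; [exact: idmul0|rewrite mulr0].
  - move=> _ _ [y hy <-] [y' hy' <-]; exists (y + y'); first exact: idmulD.
    by rewrite mulrDr.
  by move=> _ y [i Ii <-] Jy; exists (i * y); [exact: idmul_mem|rewrite mulrA].
move=> [u hu <-]; move: u hu; apply: idmul_ind.
- by rewrite mulr0; exact: idmul0.
- by move=> x y hx hy; rewrite mulrDr; exact: idmulD.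
- by move=> i j Ii Jj; rewrite mulrA; apply: idmul_mem => //; exists i.
Qed.

Lemma scale_ideal (s : C) I : s != 0 -> is_ideal D I ->
  (forall i, I i -> O (s * i)) -> is_ideal D [set s * i | i in I].
Proof.
move=> s0 [IO I0 ID IZ [x [Ix x0]]] h; split.
- by move=> _ [i Ii <-]; exact: h.
- by exists 0; rewrite ?mulr0.
- by move=> _ _ [i Ii <-] [j Ij <-]; exists (i + j); [exact: ID|rewrite mulrDr].
- by move=> r _ hr [i Ii <-]; exists (r * i); [exact: IZ|rewrite mulrCA].
- by exists (s * x); split; [exists x|rewrite mulf_neq0].
Qed.

Lemma principal_ideal (g : C) : g != 0 -> O g -> is_ideal D (principal D g).
Proof.
by move=> g0 Og; apply: scale_ideal => //; [exact: OK_ideal|move=> *; exact: OKM].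
Qed.

Lemma principal_self (g : C) : principal D g g.
Proof. by exists 1; [exact: OK1|rewrite mulr1]. Qed.

Lemma coprime_of_mem I M g : is_ideal D I -> is_ideal D M -> I g -> M (g - 1) ->
  coprime_id D I M.
Proof.
move=> hI hM Ig Mg; apply/seteqP; split=> [_ [x [y [Ix My ->]]]|r Or].
  by apply: OKD; [case: hI => h _ _ _ _|case: hM => h _ _ _ _]; exact: h.
exists (r * g), (r * (1 - g)); split; last by ring.
  by case: hI => _ _ _ h _; exact: h.
case: (hM) => _ _ _ h _; apply: h => //; rewrite -opprB.
exact: (moduleN (ideal_module hM)).
Qed.

Lemma coprime_witness I M : is_ideal D I -> is_ideal D M -> coprime_id D I M ->
  exists g, [/\ I g, g != 0 & M (g - 1)].
Proof.
move=> hI hM cop; have : O 1 by exact: OK1.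
rewrite -cop => -[g [m [Ig Mm e]]].
have Mg : M (g - 1).
  by rewrite e opprD addNKr; exact: (moduleN (ideal_module hM)).
(* The value 0 can occur only if [M] contains -1 and so is the whole order; any nonzero element of
   [I] then works. *)
have [g0|g0] := eqVneq g 0; last by exists g.
case: hI => IO _ _ _ [x [Ix x0]]; exists x; split=> //.
rewrite g0 sub0r in Mg.
have -> : x - 1 = (1 - x) * (- 1) by ring.
case: (hM) => _ _ _ h _; apply: h => //.
by apply: OKD; [exact: OK1|apply: OKN; exact: IO].
Qed.

(** The cofactor is g / N times the conjugate of [I]: it is integral because g conj(I) lies in N O,
    and complementary because I conj(I) = N O. *)
Lemma ideal_cofactor I g : is_ideal D I -> I g -> g != 0 ->
  exists B, [/\ is_ideal D B, B g & idmul I B = principal D g].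
Proof.
move=> hI Ig g0; have [N [N0 _ hN]] := idnorm_exists hD hI.
have Nne : (N%:R : C) != 0 by rewrite pnatr_eq0 -lt0n.
have hB : is_ideal D [set g / N%:R * i | i in conj_set I].
  apply: scale_ideal; [by rewrite mulf_neq0// invr_eq0|exact: conj_ideal|].
  move=> _ [i Ii <-]; have [t Ot e] := hN.1 _ _ Ig Ii.
  by rewrite mulrAC e mulrAC divff// mul1r.
have hIB : idmul I [set g / N%:R * i | i in conj_set I] = principal D g.
  rewrite idmulC idmul_scale idmulC; apply/seteqP; split=> [_ [v hv <-]|_ [r Or <-]].
    have [t Ot ->] := has_norm_sub hN hv; exists t => //.
    by rewrite mulrA divfK.
  exists (r * N%:R); last by field.
  have [_ _ h] := idmul_module I (ideal_module (conj_ideal hI)).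
  by apply: h => //; exact: hN.2.
exists [set g / N%:R * i | i in conj_set I]; split=> //.
apply: (idmul_sub_module (D := D) (I := I)); [by case: hI|exact: ideal_module|].
by rewrite hIB; exact: principal_self.
Qed.

(** The existence of [I'] matters as much as the value: it shows that the points attached to ideals
    prime to [cf] fill whole cosets of delta L, apart from 0. *)
Lemma hecke_shift (cf q K : set C) (phi : set C -> C) (z delta x x' l : C) (a b c : int) I :
  is_ideal D cf -> hecke_mod D cf phi -> is_ideal D q -> is_ideal D K ->
  principal D delta = idmul (idmul q K) cf ->
  primitive_form D z a b c -> x != 0 -> x' != 0 -> L z l -> x - x' = delta * l ->
  is_ideal D I -> coprime_id D I cf -> inv_lattice a z x = idmul q I ->
  exists I', [/\ is_ideal D I', coprime_id D I' cf,
    inv_lattice a z x' = idmul q I' & phi I' * x = phi I * x'].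
Proof.
move=> hcf [chi [[chi1 _ chi3] phi0 phiM phiP]] hq hK cE pf x0 x0' Ll xx' hI copI Ix.
have mcf := ideal_module hcf; case: (hcf) => cfO _ cfD cfZ _.
case: (hI) => IO _ _ _ _.
set s := x' / x; have s0 : s != 0 by rewrite mulf_neq0// invr_eq0.
have sub v : idmul (idmul q K) cf v -> idmul q cf v.
  move: v; apply: idmul_ind; [exact: idmul0|exact: idmulD|].
  move=> u y hu cfy; move: u hu; apply: idmul_ind.
  - by rewrite mul0r; exact: idmul0.
  - by move=> u u' hu hu'; rewrite mulrDl; exact: idmulD.
  move=> t k qt Kk; rewrite -mulrA; apply: idmul_mem => //.
  by apply: cfZ => //; case: hK => h _ _ _ _; exact: h.
(* The set (1 - s) q I = (x - x') (a conj L) = delta l (a conj L) lies in (delta) = q K cf;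
   cancelling [q] leaves [cf]. *)
have near i : I i -> cf ((1 - s) * i).
  move=> Ii; apply: (ideal_cancel hD hq mcf) => t qt.
  have : idmul q I (t * i) by exact: idmul_mem.
  rewrite -Ix => -[y Ly e]; apply: sub; rewrite -cE.
  exists (a%:~R * (l * cj y)); first exact: (lat_conj_OK hD pf).
  have -> : t * ((1 - s) * i) = (1 - s) * (t * i) by ring.
  have -> : delta * (a%:~R * (l * cj y)) = (delta * l) * (a%:~R * cj y) by ring.
  by rewrite -e -xx' /s; field.
have sI i : I i -> O (s * i).
  move=> Ii; have -> : s * i = i - (1 - s) * i by ring.
  by apply: OKD; [exact: IO|apply: OKN; apply: cfO; exact: near].
have hI' := scale_ideal s0 hI sI.
have [g [Ig g0 g1]] := coprime_witness hI hcf copI.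
have sg1 : cf (s * g - 1).
  have -> : s * g - 1 = (g - 1) - (1 - s) * g by ring.
  by apply: (moduleB mcf) => //; exact: near.
have copI' : coprime_id D [set s * i | i in I] cf.
  by apply: (coprime_of_mem hI' hcf _ sg1); exists g.
have [B [hB Bg IB]] := ideal_cofactor hI Ig g0.
have copB : coprime_id D B cf by exact: coprime_of_mem Bg g1.
have I'B : idmul [set s * i | i in I] B = principal D (s * g).
  rewrite idmul_scale IB; apply/seteqP; split=> [_ [_ [r Or <-] <-]|_ [r Or <-]].
    by exists r => //; rewrite mulrA.
  by exists (g * r); [exists r|rewrite mulrA].
(* For [h] congruent to 1 modulo [cf] the factor [chi h] equals [chi 1], that is 1. *)
have phi_pr h : h != 0 -> O h -> cf (h - 1) -> phi (principal D h) = h.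
  move=> h0 Oh h1.
  have coph : coprime_id D (principal D h) cf.
    by apply: coprime_of_mem (principal_self h) h1 => //; exact: principal_ideal.
  have cop1 : coprime_id D (principal D 1) cf.
    apply: coprime_of_mem (principal_self 1) _ => //.
      by apply: principal_ideal; [rewrite oner_eq0|exact: OK1].
    by rewrite subrr; case: mcf.
  by rewrite phiP// (chi1 h 1)// ?chi3 ?mulr1//; exact: OK1.
exists [set s * i | i in I]; split=> //.
  rewrite idmulC idmul_scale idmulC -Ix inv_lattice_scale /s divfK//.
have e1 : phi I * phi B = g.
  by rewrite -phiM// IB phi_pr//; exact: IO.
have e2 : phi [set s * i | i in I] * phi B = s * g.
  by rewrite -phiM// I'B phi_pr//; [rewrite mulf_neq0|exact: sI].
apply: (mulIf (phi0 _ hB copB)).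
by rewrite mulrAC e2 [RHS]mulrAC e1 /s; field.
Qed.

End HeckeShift.

(** * Regrouping of finite sums *)

Section FiniteSums.
Variable R : realType.
Local Notation C := R[i].

Lemma fsum_partition (T U : choiceType) (A : set T) (l : seq U) (h : T -> U)
    (F : T -> C) : finite_set A -> uniq l -> (forall x, A x -> h x \in l) ->
  \sum_(y <- l) \sum_(x \in A `&` [set x | h x = y]) F x = \sum_(x \in A) F x.
Proof.
move=> finA ul hl.
under eq_bigr do rewrite fsbig_mkcondr fsbig_finite//.
rewrite exchange_big fsbig_finite//= big_seq [RHS]big_seq.
apply: eq_bigr => x; rewrite in_fset_set// inE => Ax.
rewrite (bigD1_seq (h x)) ?hl//= mem_set// big1 ?addr0// => y /negP neq.
by rewrite memNset// => /= e; apply: neq; rewrite e.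
Qed.

(** Meant for [h] sending a lattice point to its ideal, where each fibre is a unit orbit and [W] the
    number of units. *)
Lemma fsum_fibers (T U : choiceType) (A : set T) (B : set U) (h : T -> U)
    (F : U -> C) (W : C) : finite_set A -> finite_set B ->
  (forall x, A x -> B (h x)) ->
  (forall y, B y -> \sum_(x \in A `&` [set x | h x = y]) (1 : C) = W) ->
  \sum_(x \in A) F (h x) = W * \sum_(y \in B) F y.
Proof.
move=> finA finB AB hW.
rewrite -(@fsum_partition _ _ A (fset_set B) h)//; last first.
  by move=> x Ax; rewrite in_fset_set// inE; exact: AB.
rewrite [in RHS]fsbig_finite// mulr_sumr big_seq [RHS]big_seq.
apply: eq_bigr => y; rewrite in_fset_set// inE => By.
rewrite -(hW _ By) mulrC mulr_fsumr.
by apply: eq_fsbigr => x /set_mem[_ /= ->]; rewrite mulr1.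
Qed.

End FiniteSums.

(** * Lattice points of bounded norm, and units *)

Section LatticeSums.
Variable (R : realType).
Local Notation C := R[i].
Local Notation cj := (@conjc R).
Local Notation L := (@lattice_tau R).

Lemma mul_conj (x : C) : x * cj x = (complex.Re x ^+ 2 + complex.Im x ^+ 2)%:C.
Proof.
case: x => r t; apply/eqP; rewrite eq_complex /=; apply/andP.
by split; apply/eqP; ring.
Qed.

Lemma Re_intM (n : int) (z : C) : complex.Re (n%:~R * z) = n%:~R * complex.Re z.
Proof.
by rewrite -(rmorph_int (real_complex R)); case: z => x y /=; rewrite mul0r subr0.
Qed.

Lemma Re_int (n : int) : complex.Re (n%:~R : C) = n%:~R.
Proof. by rewrite -(rmorph_int (real_complex R)). Qed.

Lemma ReD (x y : C) : complex.Re (x + y) = complex.Re x + complex.Re y.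
Proof. by case: x; case: y. Qed.

(** The imaginary part n Im z bounds [n], and the real part m + n Re z then bounds [m]. A bound
    linear in N is cruder than the square root but suffices for polynomial growth. *)
Lemma lattice_box (z : C) : 0 < complex.Im z -> exists B : nat,
  forall (N : nat) (m n : int),
    (m%:~R + n%:~R * z) * cj (m%:~R + n%:~R * z) <= N%:R ->
    (`|m| <= B * N.+1)%N /\ (`|n| <= B * N.+1)%N.
Proof.
set v := complex.Im z => v0; set u := complex.Re z.
(* One constant for both bounds, (N + 1)/v for [n] and (N + 1)(1 + |u|/v) for [m]. *)
set Q := 1 + (1 + `|u|) / v.
have Q0 : 0 <= Q.
  by rewrite addr_ge0// divr_ge0 ?(ltW v0)// addr_ge0.
exists (Num.bound Q) => N m n.
rewrite mul_conj ReD ImD Re_int Im_int add0r Re_intM Im_intM -/u -/v.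
rewrite -(rmorph_nat (real_complex R)) lecR.
set r := m%:~R + n%:~R * u; set t := n%:~R * v => h.
have bnd (y : R) : y ^+ 2 <= N%:R -> `|y| <= N.+1%:R.
  move=> hy; rewrite -ler_sqr ?nnegrE// real_normK ?num_real//.
  apply: le_trans hy _; rewrite -natrX ler_nat; nia.
have hr : `|r| <= N.+1%:R by apply: bnd; have := sqr_ge0 t; lra.
have ht : `|t| <= N.+1%:R by apply: bnd; have := sqr_ge0 r; lra.
have hn : `|n%:~R| <= N.+1%:R / v :> R.
  by rewrite ler_pdivlMr// -[X in _ * X](gtr0_norm v0) -normrM.
have BQ : Q < (Num.bound Q)%:R by exact: archi_boundP.
have fin (k : int) : `|k%:~R| <= N.+1%:R * Q -> (`|k| <= Num.bound Q * N.+1)%N.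
  move=> hk; rewrite -(ler_nat R) natr_absz -intr_norm in hk *.
  apply: le_trans hk _; rewrite natrM mulrC ler_wpM2r// ltW//.
split; apply: fin.
  have -> : m%:~R = r - n%:~R * u by rewrite /r addrK.
  apply: le_trans (ler_normB _ _) _; rewrite normrM.
  have : `|n%:~R| * `|u| <= N.+1%:R / v * `|u| by rewrite ler_wpM2r.
  have : 0 <= N.+1%:R / v by rewrite divr_ge0// ltW.
  have -> : N.+1%:R * Q = N.+1%:R + N.+1%:R / v + N.+1%:R / v * `|u|.
    by rewrite /Q; field; rewrite gt_eqF.
  lra.
apply: le_trans hn _.
have -> : N.+1%:R * Q = N.+1%:R + N.+1%:R / v + N.+1%:R / v * `|u|.
  by rewrite /Q; field; rewrite gt_eqF.
have : 0 <= N.+1%:R / v * `|u| by rewrite mulr_ge0// divr_ge0// ltW.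
have : 0 <= N.+1%:R :> R by [].
lra.
Qed.

(** The explicit list gives a count quadratic in N, not only finiteness; the growth of the
    coefficients is bounded with it. *)
Lemma lattice_ball_box (z : C) : 0 < complex.Im z -> exists B : nat, forall N : nat,
  exists2 l : seq C, size l = ((B * N.+1).*2.+1 * (B * N.+1).*2.+1)%N &
  forall x, L z x -> x * cj x <= N%:R -> x \in l.
Proof.
move=> z0; have [B hB] := lattice_box z0; exists B => N.
set M := (B * N.+1)%N; pose ints := [seq i%:Z - M%:Z | i <- iota 0 M.*2.+1].
have intsP (k : int) : (`|k| <= M)%N -> k \in ints.
  move=> hk; apply/mapP; exists (absz (k + M%:Z)); last by lia.
  by rewrite mem_iota; lia.
exists [seq m%:~R + n%:~R * z | m <- ints, n <- ints].
  by rewrite size_allpairs size_map size_iota.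
by move=> _ [m [n ->]] /hB[hm hn]; apply/allpairsP; exists (m, n); split=> //=; exact: intsP.
Qed.

Lemma finite_lattice_ball (z : C) N : 0 < complex.Im z ->
  finite_set [set x | L z x /\ x * cj x <= N%:R].
Proof.
move=> /lattice_ball_box[B /(_ N)[l _ hl]].
apply: (@sub_finite_set _ _ [set` l]); last exact: finite_seq.
by move=> x [] /=; exact: hl.
Qed.

Variables (D : int) (hD : neg_fund_disc D).
Local Notation s := (sqrtD R D).
Local Notation O := (@OK R D).

(** The norms of a unit and of its inverse are positive integers with product 1, so units lie in the
    unit ball of the lattice [1, omegaK]. *)
Lemma finite_units : finite_set (@OK_unit R D).
Proof.
apply: sub_finite_set (@finite_lattice_ball (omegaK R D) 1 (omega_Im R hD.1)).
move=> u [u0 Ou Ou']; split=> //=.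
have realint v : O v -> v != 0 -> exists2 m : int, 0 < m & v * cj v = m%:~R.
  move=> Ov v0.
  have [|m mE] := OK_real hD.1 (OKM hD Ov (OK_conj Ov)).
    by rewrite conjcM conjcK mulrC.
  exists m => //; rewrite -(ltr0z C) -mE mul_conj ltcR.
  rewrite lt_neqAle addr_ge0 ?sqr_ge0// andbT eq_sym.
  by rewrite -(inj_eq (@complexI R)) -mul_conj mulf_neq0// conjc_eq0.
have [m m0 mE] := realint u Ou u0.
have [|m' m'0 m'E] := realint _ Ou'; first by rewrite invr_eq0.
have mm : m * m' = 1.
  apply: (@intr_inj C); rewrite intrM -mE -m'E conjc_inv.
  by field; rewrite conjc_eq0 u0.
have -> : u * cj u = 1%:~R by rewrite mE; congr (_%:~R); nia.
by [].
Qed.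

Lemma units_count : \sum_(u \in @OK_unit R D) (1 : C) != 0.
Proof.
rewrite fsbig_finite; last exact: finite_units.
rewrite big_const_seq count_predT iter_addr_0 pnatr_eq0 size_eq0.
apply/eqP => e; have : (1 : C) \in fset_set (@OK_unit R D).
  rewrite in_fset_set ?inE; last exact: finite_units.
  by split; rewrite ?oner_eq0 ?invr1//; exact: OK1.
by rewrite -[_ \in _]/(1 \in (fset_set (@OK_unit R D) : seq C)) e.
Qed.

End LatticeSums.

(** * Convergence of q-series *)

Section QSeries.
Variable R : realType.
Local Notation C := R[i].
Implicit Types (c : nat -> C) (tau : C).

Lemma norm_split (x : C) : `|x| <= (`|complex.Re x| + `|complex.Im x|)%:C.
Proof.
rewrite normc_def lecR -[leRHS]ger0_norm ?addr_ge0// -sqrtr_sqr ler_wsqrtr//.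
rewrite sqrrD !real_normK ?num_real// lerD2r lerDl mulrn_wge0// mulr_ge0//.
Qed.

Lemma norm_Re (x : C) (r : R) : `|x| <= r%:C -> `|complex.Re x| <= r.
Proof. by rewrite -lecR; apply: le_trans; exact: normc_ge_Re. Qed.

Lemma norm_Im (x : C) (r : R) : `|x| <= r%:C -> `|complex.Im x| <= r.
Proof.
rewrite normc_def lecR; apply: le_trans.
by rewrite -sqrtr_sqr ler_wsqrtr// lerDr sqr_ge0.
Qed.

Lemma norm_e2pi (x : C) : `|e2pi x| = (expR (- (2 * pi * complex.Im x)))%:C.
Proof.
rewrite /e2pi normrM [X in _ * X]normc_def /= cos2Dsin2 sqrtr1 mulr1.
by rewrite ger0_norm// ler0c expR_ge0.
Qed.

Lemma qconv_uniq c tau l l' : qconv c tau l -> qconv c tau l' -> l = l'.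
Proof.
move=> h h'; apply/eqP; rewrite -subr_eq0 -normr_eq0; apply/eqP.
set r := complex.Re `|l - l'|.
have rE : `|l - l'| = r%:C by rewrite /r normc_def.
have r0 : 0 <= r by rewrite -ler0c -rE normr_ge0.
have [r00|rn] := eqVneq r 0; first by rewrite rE r00.
have e0 : 0 < r / 2 by rewrite divr_gt0// lt_neqAle eq_sym rn.
have [N hN] := h _ e0; have [N' hN'] := h' _ e0.
have := hN (maxn N N') (leq_maxl _ _); have := hN' (maxn N N') (leq_maxr _ _).
set S := \sum_(_ < _) _ => h2 h1.
have : `|l - l'| < (r / 2 + r / 2)%:C.
  have -> : l - l' = (S - l') - (S - l) by ring.
  by rewrite rmorphD /=; apply: le_lt_trans (ler_normB _ _) _; rewrite ltrD.
by rewrite rE ltcR -splitr ltxx.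
Qed.

Lemma qvalE c tau l : qconv c tau l -> qval c tau = l.
Proof.
move=> h; rewrite /qval; case: pselect => [P|[]]; last by exists l.
by apply: (@qconv_uniq c tau) => //; case: cid.
Qed.

Lemma qconv0 tau : qconv (fun=> 0) tau 0.
Proof.
move=> eps e0; exists 0%N => M _; rewrite big1 => [|i _]; last by rewrite mul0r.
by rewrite subrr normr0 -[0]/((0 : R)%:C) ltcR.
Qed.

Lemma qconvD c c' tau l l' : qconv c tau l -> qconv c' tau l' ->
  qconv (fun n => c n + c' n) tau (l + l').
Proof.
move=> h h' eps e0; have e2 : 0 < eps / 2 by rewrite divr_gt0.
have [N hN] := h _ e2; have [N' hN'] := h' _ e2.
exists (maxn N N') => M; rewrite geq_max => /andP[/hN h1 /hN' h2].
under eq_bigr do rewrite mulrDl.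
rewrite big_split /= opprD addrACA [eps]splitr rmorphD /=.
by apply: le_lt_trans (ler_normD _ _) _; rewrite ltrD.
Qed.

Lemma qconvZ k c tau l : qconv c tau l -> qconv (fun n => k * c n) tau (k * l).
Proof.
move=> h eps e0; set r := complex.Re `|k|.
have rE : `|k| = r%:C by rewrite /r normc_def.
have r0 : 0 <= r by rewrite -ler0c -rE normr_ge0.
have e1 : 0 < eps / (r + 1) by rewrite divr_gt0// ltr_wpDl.
have [N hN] := h _ e1; exists N => M /hN h1.
under eq_bigr do rewrite -mulrA.
rewrite -mulr_sumr -mulrBr normrM rE.
apply: le_lt_trans (ler_wpM2l _ (ltW h1)) _; first by rewrite ler0c.
rewrite -rmorphM ltcR /= mulrA ltr_pdivrMr ?ltr_wpDl// mulrC ltr_pM2l//.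
by rewrite ltrDl.
Qed.

Lemma qconv_sum (T : Type) (l : seq T) (k : T -> C) (u : T -> nat -> C) (v : T -> C) tau :
  (forall p, List.In p l -> qconv (u p) tau (v p)) ->
  qconv (fun n => \sum_(p <- l) k p * u p n) tau (\sum_(p <- l) k p * v p).
Proof.
elim: l => [|p l IH] h.
  rewrite big_nil; have -> : (fun n => \sum_(p <- [::]) k p * u p n) = (fun=> 0).
    by apply/funext => n; rewrite big_nil.
  exact: qconv0.
rewrite big_cons.
have -> : (fun n => \sum_(p0 <- p :: l) k p0 * u p0 n) =
    (fun n => k p * u p n + \sum_(p0 <- l) k p0 * u p0 n).
  by apply/funext => n; rewrite big_cons.
apply: qconvD; first by apply: qconvZ; apply: h; left.
by apply: IH => p' h'; apply: h; right.
Qed.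

(** The partial sums of [c] at d' tau are those of the sparse series [c'] at tau, taken at the
    multiples of [d']. *)
Lemma qconv_spread (d' : nat) c c' tau l : (0 < d')%N ->
  (forall m, c' (d' * m)%N = c m) -> (forall n, ~~ (d' %| n)%N -> c' n = 0) ->
  qconv c' tau l -> qconv c (d'%:R * tau) l.
Proof.
move=> d0 h1 h2 h eps e0; have [N hN] := h _ e0; exists N => M NM.
suff -> : \sum_(n < M) c n * e2pi (n%:R * (d'%:R * tau)) =
          \sum_(n < d' * M) c' n * e2pi (n%:R * tau).
  by apply: hN; rewrite (leq_trans NM)// leq_pmull.
elim: M {NM} => [|M IH]; first by rewrite muln0 !big_ord0.
rewrite big_ord_recr /= IH -!(big_mkord xpredT (fun n => c' n * e2pi (n%:R * tau))).
rewrite mulnS addnC [RHS](big_cat_nat _ (n := (d' * M)%N)) ?leq_addr//=; congr (_ + _).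
(* In the block from d' M to d' (M + 1) only the first index is divisible by [d']. *)
rewrite big_ltn; last by rewrite -[X in (X < _)%N]addn0 ltn_add2l.
rewrite big_nat big1 ?addr0 => [|n /andP[n1 n2]].
  by rewrite h1; congr (_ * e2pi _); rewrite natrM; ring.
rewrite h2 ?mul0r//; apply/negP => /dvdnP[t tE].
by move: n1 n2; rewrite tE (mulnC t) (addnC _ d') -mulnS ltn_pmul2l// ltn_pmul2l// ltnS; case: ltngtP.
Qed.

(** Real and imaginary parts are compared separately with a real geometric series. *)
Lemma qconv_geometric c tau (K r : R) : 0 <= r -> r < 1 ->
  (forall n, `|c n * e2pi (n%:R * tau)| <= (K * r ^+ n)%:C) ->
  exists l, qconv c tau l.
Proof.
move=> r0 r1 hb; pose t n := c n * e2pi (n%:R * tau).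
have cvg_of (u : nat -> R) : (forall n, `|u n| <= K * r ^+ n) ->
    exists l, forall eps, 0 < eps -> exists N, forall M, (N <= M)%N ->
      `|\sum_(n < M) u n - l| < eps.
  move=> hu.
  have cu : cvgn (series u).
    apply: normed_cvg; apply: (series_le_cvg (v_ := geometric K r)) => //.
    - by move=> n; exact: normr_ge0.
    - by move=> n; exact: le_trans (normr_ge0 _) (hu n).
    - by apply: is_cvg_geometric_series; rewrite ger0_norm.
  exists (limn (series u)) => eps e0.
  have /cvgrPdist_lt/(_ _ e0)[N _ hN] := cu; exists N => M NM.
  by have := hN M NM; rewrite /= distrC /series /= big_mkord.
have [lr hr] : exists l, forall eps, 0 < eps -> exists N, forall M, (N <= M)%N ->
    `|\sum_(n < M) complex.Re (t n) - l| < eps.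
  by apply: (cvg_of (fun n => complex.Re (t n))) => n; apply: norm_Re; exact: hb.
have [li hi] : exists l, forall eps, 0 < eps -> exists N, forall M, (N <= M)%N ->
    `|\sum_(n < M) complex.Im (t n) - l| < eps.
  by apply: (cvg_of (fun n => complex.Im (t n))) => n; apply: norm_Im; exact: hb.
exists (lr +i* li) => eps e0; have e2 : 0 < eps / 2 by rewrite divr_gt0.
have [N hN] := hr _ e2; have [N' hN'] := hi _ e2.
exists (maxn N N') => M; rewrite geq_max => /andP[/hN h1 /hN' h2].
apply: le_lt_trans (norm_split _) _; rewrite ltcR [eps]splitr ltrD//.
  suff -> : complex.Re (\sum_(n < M) t n - (lr +i* li)) =
    \sum_(n < M) complex.Re (t n) - lr by [].
  rewrite ReD /=; congr (_ - _).
  by elim/big_rec2 : _ => // i x y _ <-; rewrite ReD.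
suff -> : complex.Im (\sum_(n < M) t n - (lr +i* li)) =
  \sum_(n < M) complex.Im (t n) - li by [].
rewrite ImD /=; congr (_ - _).
by elim/big_rec2 : _ => // i x y _ <-; rewrite ImD.
Qed.

(** With t = pi Im tau, the decay e^(-2tn) is split in two: one half absorbs the cubic growth, the
    other is the ratio of a geometric series. *)
Lemma qconv_cubic c tau (K : R) : upper tau ->
  (forall n, `|c n| <= (K * n.+1%:R ^+ 3)%:C) -> exists l, qconv c tau l.
Proof.
rewrite /upper => tau0 hc; set t := pi * complex.Im tau.
have t0 : 0 < t by rewrite mulr_gt0// pi_gt0.
have K0 : 0 <= K.
  by have := le_trans (normr_ge0 _) (hc 0%N); rewrite ler0c expr1n mulr1.
apply: (@qconv_geometric _ _ (K * (3 / t) ^+ 3 * expR t) (expR (- t))).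
- exact: expR_ge0.
- by rewrite expR_lt1 oppr_lt0.
move=> n; rewrite normrM norm_e2pi.
have -> : complex.Im (n%:R * tau) = n%:R * complex.Im tau.
  by rewrite -[n%:R]/(n%:Z%:~R) Im_intM.
apply: (@le_trans _ _ ((K * n.+1%:R ^+ 3)%:C * (expR (- (2 * pi * (n%:R * complex.Im tau))))%:C)).
  by apply: ler_wpM2r (hc n); rewrite ler0c expR_ge0.
rewrite -rmorphM lecR /=.
have -> : expR (- (2 * pi * (n%:R * complex.Im tau))) = expR (- t) ^+ n * expR (- t) ^+ n.
  by rewrite -!expRM_natl -expRD; congr expR; rewrite /t; ring.
(* This is y <= e^y at y = t (n + 1) / 3, cubed; it is the source of the constant (3 / t)^3 e^t. *)
have cube : n.+1%:R ^+ 3 <= (3 / t) ^+ 3 * (expR t * expR t ^+ n).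
  have -> : expR t * expR t ^+ n = expR (t * n.+1%:R / 3) ^+ 3.
    by rewrite -exprS -!expRM_natl; congr expR; field.
  rewrite -exprMn; apply: lerXn2r; first by rewrite nnegrE.
    by rewrite nnegrE mulr_ge0 ?expR_ge0// divr_ge0// ltW.
  have := expR_ge1Dx (t * n.+1%:R / 3) => h.
  have {}h : t * n.+1%:R / 3 <= expR (t * n.+1%:R / 3) by apply: le_trans h; rewrite lerDr.
  have nE : n.+1%:R = 3 / t * (t * n.+1%:R / 3) :> R by field; rewrite gt_eqF.
  by rewrite [leLHS]nE ler_wpM2l// divr_ge0// ltW.
have en : expR t ^+ n * expR (- t) ^+ n = 1.
  by rewrite -exprMn -expRD subrr expR0 expr1n.
have e0 : 0 <= expR (- t) ^+ n * expR (- t) ^+ n by rewrite mulr_ge0// exprn_ge0// expR_ge0.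
apply: le_trans (ler_wpM2r e0 (ler_wpM2l K0 cube)) _.
rewrite le_eqVlt; apply/orP; left; apply/eqP.
transitivity (K * (3 / t) ^+ 3 * expR t * expR (- t) ^+ n * (expR t ^+ n * expR (- t) ^+ n)).
  by ring.
by rewrite en mulr1.
Qed.

End QSeries.

(** * The generators [fa] as sums over cosets of delta L *)

Section Generators.
Variables (R : realType) (D : int) (hD : neg_fund_disc D) (f : nat) (f0 : (0 < f)%N).
Local Notation C := R[i].
Local Notation cj := (@conjc R).
Local Notation L := (@lattice_tau R).
Local Notation s := (sqrtD R D).
Local Notation O := (@OK R D).
Local Notation delta := (f%:R * s).
Variables (z : C) (a b c : int) (pf : primitive_form D z a b c).

Definition lattice_cong (x y : C) : Prop := exists2 l, L z l & x - y = delta * l.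

Definition lattice_sphere (n : nat) : set C :=
  [set x | L z x /\ a%:~R * (x * cj x) = n%:R].

(** [Omega'] rescaled so that the dual lattice becomes L = Z + Z z and the original lattice becomes
    delta L. *)
Definition dual_embed (y : rat * rat) : C := delta * (ratr y.1 - ratr y.2 * z).

(** The ratio of [Omega'] to [dual_embed]. *)
Definition gen_scale : C := (Num.sqrt ((2 * a * f%:Z)%:~R : R))%:C / delta.

Lemma delta_neq0 : delta != 0.
Proof.
rewrite mulf_neq0 ?pnatr_eq0 -?lt0n//.
apply: contraTneq (sqrtD_Im R hD.1) => ->; by rewrite ltxx.
Qed.

Lemma gen_scale_neq0 : gen_scale != 0.
Proof.
rewrite mulf_neq0 ?invr_eq0 ?delta_neq0// -[0]/((0 : R)%:C) (inj_eq (@complexI R)).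
by case: pf => a0 _ _ _; rewrite gt_eqF// sqrtr_gt0 ltr0z !mulr_gt0// ltz_nat.
Qed.

Lemma lattice_cong_sym x y : lattice_cong x y -> lattice_cong y x.
Proof.
by move=> [l Ll e]; exists (- l); [exact: latN|rewrite mulrN -e opprB].
Qed.

Lemma lattice_cong_trans y x t : lattice_cong x y -> lattice_cong y t -> lattice_cong x t.
Proof.
move=> [l Ll e] [l' Ll' e']; exists (l + l'); first exact: latD.
by rewrite mulrDr -e -e'; ring.
Qed.

Lemma OK_sqrtD : O s.
Proof. by exists (- D), 2; rewrite rmorphN /= omega2; ring. Qed.

Lemma lattice_cong_lat x y : L z y -> lattice_cong x y -> L z x.
Proof.
move=> Ly [l Ll e]; have -> : x = y + delta * l by rewrite -e; ring.
apply: latD => //; apply: (lat_OK hD pf) => //.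
by apply: OKM => //; [exact: OK_nat|exact: OK_sqrtD].
Qed.

Lemma lattice_sphere_le n x : lattice_sphere n x -> x * cj x <= n%:R.
Proof.
move=> [Lx e]; rewrite -e ler_peMl//.
  by rewrite mul_conj ler0c addr_ge0// sqr_ge0.
by case: pf => a0 _ _ _; rewrite -[1]/(1%:~R) ler_int.
Qed.

Lemma finite_lattice_sphere n : finite_set (lattice_sphere n).
Proof.
apply: sub_finite_set (finite_lattice_ball n (pf_Im hD pf)) => x hx.
by split; [case: hx|exact: lattice_sphere_le].
Qed.

Lemma coset_reps : exists (l : seq C) (rep : C -> C),
  [/\ uniq l, (forall y, y \in l -> L z y), (forall x, L z x -> rep x \in l) &
      forall x y, L z x -> y \in l -> lattice_cong x y <-> rep x = y].
Proof.
pose M := (f * `|D|)%N.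
(* The integer f |D| is a multiple of [delta] in the order, so reducing both coordinates modulo it
   meets every coset, possibly several times. *)
have ME : (M%:R : C) = delta * (- s).
  rewrite mulrN -mulrA (sqrtD_sq R hD.1) natrM -[ `|D|%N%:R]/(`|D|%N%:Z%:~R) ltz0_abs ?hD.1//.
  by rewrite rmorphN /= mulrN.
have M0 : (M%:Z : int) != 0.
  by have := hD.1; move: f0; rewrite /M; nia.
pose gr := [seq i%:R + j%:R * z | i <- iota 0 M, j <- iota 0 M].
have grL y : y \in gr -> L z y.
  by move=> /allpairsP[[i j] [_ _ ->]] /=; exists i%:Z, j%:Z.
have grP x : L z x -> exists2 y, y \in gr & lattice_cong x y.
  move=> [m [n ->]]; exists ((`|m %% M%:Z|%Z)%N%:R + (`|n %% M%:Z|%Z)%N%:R * z).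
    apply/allpairsP; exists (`|m %% M%:Z|%Z, `|n %% M%:Z|%Z)%N; split=> //=;
      rewrite mem_iota /= add0n; have := ltz_mod m M0; have := ltz_mod n M0;
      have := modz_ge0 m M0; have := modz_ge0 n M0; lia.
  exists (- s * ((m %/ M%:Z)%Z%:~R + (n %/ M%:Z)%Z%:~R * z)).
    apply: (lat_OK hD pf); first by apply: OKN; exact: OK_sqrtD.
    by exists (m %/ M%:Z)%Z, (n %/ M%:Z)%Z.
  rewrite mulrA -ME !pmulrn !gez0_abs ?modz_ge0//.
  by rewrite {1}(divz_eq m M%:Z) {1}(divz_eq n M%:Z); ring.
(* Congruent points define the same set here, so [xget] picks the same point for them and [rep] is
   constant on cosets. *)
pose rep x := xget 0 [set y | y \in gr /\ lattice_cong x y].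
have repP x : L z x -> rep x \in gr /\ lattice_cong x (rep x).
  by move=> /grP[y yg xy]; exact: (@xgetI _ 0 [set y | y \in gr /\ lattice_cong x y] y).
have rep_cong x y : lattice_cong x y -> rep x = rep y.
  move=> xy; congr xget; apply/seteqP; split=> t [tg ht]; split=> //.
    exact: lattice_cong_trans (lattice_cong_sym xy) ht.
  exact: lattice_cong_trans xy ht.
exists (undup [seq rep y | y <- gr]), rep; split; first exact: undup_uniq.
- move=> y; rewrite mem_undup => /mapP[t /grL Lt ->].
  by have [/grL] := repP _ Lt.
- move=> x Lx; rewrite mem_undup; have [y yg xy] := grP x Lx.
  by apply/mapP; exists y => //; exact: rep_cong.
- move=> x y Lx; rewrite mem_undup => /mapP[t tg ->].
  have [_ tr] := repP _ (grL _ tg); split=> [xy|e].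
    by rewrite (rep_cong _ _ xy); apply: rep_cong; exact: lattice_cong_sym.
  by rewrite -e; have [] := repP _ Lx.
Qed.

Lemma conj_ratr (p : rat) : cj (ratr p : C) = ratr p.
Proof. exact: fmorph_rat. Qed.

(** Half of the left side is the exponent of q in [fa]; at x = [dual_embed y] it is a |x|^2, the
    norm of the ideal attached to x. *)
Lemma gram_norm (y : rat * rat) : ratr ((f * `|D|)%:R * gram f a b c y) =
  2 * (a%:~R * (dual_embed y * cj (dual_embed y))) :> C.
Proof.
have nD : (`|D|%N%:R : C) = - (s * s).
  by rewrite -[LHS]/(`|D|%N%:Z%:~R) ltz0_abs ?hD.1// rmorphN /= (sqrtD_sq R hD.1).
rewrite /dual_embed /gram !conjcM conj_sqrtD conjc_nat conjcB conj_ratr conjcM conj_ratr.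
case: y => p r /=.
rewrite !(rmorphM, rmorphD, rmorphXn) /= !ratr_int !ratr_nat !rmorph1 nD.
set P : C := ratr p; set Q : C := ratr r.
have e : a%:~R * ((P - Q * z) * (P - Q * cj z)) =
    a%:~R * P ^+ 2 + b%:~R * P * Q + c%:~R * Q ^+ 2.
  transitivity (a%:~R * P ^+ 2 - P * Q * (a%:~R * z + a%:~R * cj z)
    + Q ^+ 2 * (a%:~R * (z * cj z))); first by ring.
  by rewrite (pf_trace pf) (pf_norm pf); ring.
transitivity (2 * (- (f%:R * f%:R * (s * s))) *
   (a%:~R * ((P - Q * z) * (P - Q * cj z)))); last by ring.
by rewrite e; ring.
Qed.

Lemma dual_point (x : C) : L z x ->
  exists2 y, in_dual f a b c y & dual_embed y = x.
Proof.
move=> [m [n ->]].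
have D0 : D != 0 by rewrite lt_eqF// hD.1.
have DQ : (D%:~R : rat) != 0 by rewrite intr_eq0.
have DC : (D%:~R : C) != 0 by rewrite intr_eq0.
have fQ : (f%:R : rat) != 0 by rewrite pnatr_eq0 -lt0n.
have fC : (f%:R : C) != 0 by rewrite pnatr_eq0 -lt0n.
have dE : D%:~R = b%:~R * b%:~R - 4 * a%:~R * c%:~R :> rat.
  by rewrite -(pf_disc hD pf); ring.
(* The coordinates, in the convention y1 - y2 z, of x / delta = sqrtD x / (f D), expanded with sqrtD
   = 2 a z + b and the equation of [z]. *)
exists ((b * m - 2 * c * n)%:~R / (f%:R * D%:~R), (b * n - 2 * a * m)%:~R / (f%:R * D%:~R)).
  split=> /=.
    exists n; apply: (mulfI DQ).
    transitivity ((n%:~R : rat) * (b%:~R * b%:~R - 4 * a%:~R * c%:~R)); last by rewrite -dE mulrC.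
    by field; rewrite fQ DQ.
  exists m; apply: (mulfI DQ).
  transitivity ((m%:~R : rat) * (b%:~R * b%:~R - 4 * a%:~R * c%:~R)); last by rewrite -dE mulrC.
  by field; rewrite fQ DQ.
rewrite /dual_embed /= !(fmorph_div, rmorphM) /= !ratr_int ratr_nat.
apply: (mulfI DC).
transitivity (s * ((b * m - 2 * c * n)%:~R - (b * n - 2 * a * m)%:~R * z)).
  by field; rewrite fC DC.
rewrite -(sqrtD_sq R hD.1) -[RHS]mulrA; congr (_ * _).
case: pf => _ _ e <-.
have -> : (2 * a%:~R * z + b%:~R) * (m%:~R + n%:~R * z) =
  2 * a%:~R * m%:~R * z + b%:~R * m%:~R + n%:~R * (2 * (a%:~R * (z * z)) + b%:~R * z).
  by ring.
by rewrite (pf_sq pf); ring.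
Qed.

Lemma fa_coefE y0 n : fa_coef D f (MkFgen z a b c y0) n = gen_scale *
  \sum_(x \in [set x | lattice_cong x (dual_embed y0) /\ a%:~R * (x * cj x) = n%:R]) x.
Proof.
have d0 := delta_neq0; have /norP[fn sn] : ~~ ((f%:R == 0 :> C) || (s == 0)).
  by rewrite -mulf_eq0.
rewrite (@reindex_fsbig _ _ _ _ _ dual_embed ([set y : rat * rat |
          [/\ is_int_rat (y.1 - y0.1), is_int_rat (y.2 - y0.2) &
              (f * `|D|)%:R * gram f a b c y = 2 * n%:R]])).
  rewrite mulr_fsumr; apply: eq_fsbigr => y _.
  by rewrite /Omega' /gen_scale /dual_embed /=; field; rewrite fn sn.
have sphere y : ((f * `|D|)%:R * gram f a b c y = 2 * n%:R) <->
    (a%:~R * (dual_embed y * cj (dual_embed y)) = n%:R).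
  have two : (2 : C) != 0 by rewrite pnatr_eq0.
  have r2n : ratr (2 * n%:R) = 2 * n%:R :> C by rewrite -natrM ratr_nat natrM.
  split=> [/(congr1 (@ratr C))|e].
    by rewrite gram_norm r2n => /(mulfI two).
  apply: (@fmorph_inj _ _ (@ratr C)).
  by rewrite -[LHS]/(ratr _) -[RHS]/(ratr _) gram_norm e r2n.
have shift y m k : y.1 - y0.1 = m%:~R -> y.2 - y0.2 = k%:~R ->
    dual_embed y - dual_embed y0 = delta * (m%:~R + (- k)%:~R * z).
  move=> /(congr1 (@ratr C)) e1 /(congr1 (@ratr C)) e2.
  move: e1 e2; rewrite !rmorphB /= !ratr_int rmorphN /= => <- <-.
  by rewrite /dual_embed; ring.
split.
- move=> y [[m e1] [k e2] /sphere e3]; split=> //.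
  exists (m%:~R + (- k)%:~R * z); first by exists m, (- k).
  exact: shift.
- move=> y y' /set_mem[[m e1] [k e2] _] /set_mem[[m' e1'] [k' e2'] _] e.
  have : delta * (m%:~R + (- k)%:~R * z) = delta * (m'%:~R + (- k')%:~R * z).
    by rewrite -(shift y)// -(shift y')// e.
  move=> /(mulfI d0)/(lattice_coord (pf_Im hD pf))[em /oppr_inj ek].
  have h1 : y.1 = y'.1 by apply: (@addIr _ (- y0.1)); rewrite e1 e1' em.
  have h2 : y.2 = y'.2 by apply: (@addIr _ (- y0.2)); rewrite e2 e2' ek.
  by rewrite [y]surjective_pairing [y']surjective_pairing h1 h2.
- move=> x [[_ [m [k ->]] e] hx].
  have e' : dual_embed (y0.1 + m%:~R, y0.2 - k%:~R) = x.
    apply: (@addIr _ (- dual_embed y0)); rewrite e.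
    rewrite (@shift _ m (- k)) ?opprK//=; first by ring.
    by rewrite rmorphN /=; ring.
  exists (y0.1 + m%:~R, y0.2 - k%:~R) => //; split=> /=.
  + by exists m; ring.
  + by exists (- k); rewrite rmorphN /=; ring.
  + by apply/sphere; rewrite e'.
Qed.

(** A number of points quadratic in n contributes, each of absolute value at most n + 1. *)
Lemma fa_coef_bound y0 : L z (dual_embed y0) -> exists K : R, forall n,
  `|fa_coef D f (MkFgen z a b c y0) n| <= (K * n.+1%:R ^+ 3)%:C.
Proof.
move=> Ly0; have [B hB] := lattice_ball_box (pf_Im hD pf).
exists (complex.Re `|gen_scale| * (B.*2.+1 * B.*2.+1)%:R) => n.
set g := complex.Re `|gen_scale|.
have nE : `|gen_scale| = g%:C by rewrite /g normc_def.
rewrite fa_coefE normrM nE.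
have -> : (g * (B.*2.+1 * B.*2.+1)%:R * n.+1%:R ^+ 3)%:C =
    g%:C * ((B.*2.+1 * B.*2.+1)%:R * n.+1%:R ^+ 3)%:C by rewrite -mulrA rmorphM.
rewrite ler_wpM2l//; first by rewrite -nE normr_ge0.
set X := [set x | _].
have XS : X `<=` lattice_sphere n.
  by move=> x [xy nx]; split=> //; exact: lattice_cong_lat xy.
have Xfin : finite_set X by exact: sub_finite_set XS (finite_lattice_sphere n).
rewrite fsbig_finite//; apply: le_trans (ler_norm_sum _ _ _) _.
have [l sl hl] := hB n.
have sz : (size (fset_set X) <= size l)%N.
  apply: uniq_leq_size; first exact: fset_uniq.
  move=> x; rewrite in_fset_set// inE => /XS hx; apply: hl; first by case: hx.
  exact: lattice_sphere_le.
apply: (@le_trans _ _ (\sum_(x <- fset_set X) n.+1%:R)).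
  rewrite big_seq [leRHS]big_seq; apply: ler_sum => x.
  rewrite in_fset_set// inE => /XS/lattice_sphere_le hx.
  rewrite -ler_sqr ?nnegrE// normCK; apply: le_trans hx _.
  by rewrite -natrX ler_nat; nia.
rewrite big_const_seq count_predT iter_addr_0 -mulrnA.
rewrite -(rmorph_nat (real_complex R)) lecR /= -natrX -natrM ler_nat.
have : (size (fset_set X) <= (B.*2.+1 * n.+1) * (B.*2.+1 * n.+1))%N.
  by apply: leq_trans sz _; rewrite sl; apply: leq_mul; nia.
move=> h; apply: leq_trans (leq_mul (leqnn n.+1) h) _.
by rewrite !expnS expn0 muln1 -!mulnA leq_eqVlt; apply/orP; left; apply/eqP; ring.
Qed.

(** The condition on [G] says without division that G(x) / x is constant on cosets of delta L. On
    each coset [G] is then a constant times x, and summing it gives a multiple of one [fa]. *)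
Lemma span_of_equivariant (zs : seq C) (G : C -> C) : z \in zs -> G 0 = 0 ->
  (forall x x', L z x -> L z x' -> lattice_cong x x' -> G x * x' = G x' * x) ->
  exists2 l : seq (C * Fgen R), (forall p, List.In p l -> valid_gen D f zs p.2 /\
      forall tau, upper tau -> exists v, qconv (fa_coef D f p.2) tau v) &
    forall n, \sum_(p <- l) p.1 * fa_coef D f p.2 n = \sum_(x \in lattice_sphere n) G x.
Proof.
move=> zin G0 Gcong; have [l [rep [ul lL repl repP]]] := coset_reps.
have ratio y : exists h, forall x, L z x -> lattice_cong x y -> G x = h * x.
  have [[x1 [Lx1 x1y x10]]|no] := pselect (exists x, [/\ L z x, lattice_cong x y & x != 0]).
    exists (G x1 / x1) => x Lx xy.
    have := Gcong _ _ Lx Lx1 (lattice_cong_trans xy (lattice_cong_sym x1y)).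
    by move=> e; apply: (mulIf x10); rewrite e; field.
  (* Only x = 0 can satisfy the hypotheses here, and [G] vanishes there, so the constant is
     arbitrary. *)
  exists 0 => x Lx xy; have [->|x0] := eqVneq x 0; first by rewrite G0 mulr0.
  by case: no; exists x.
have [h hP] := choice ratio.
have pts y : exists y0, L z y -> in_dual f a b c y0 /\ dual_embed y0 = y.
  have [/dual_point[y0 h1 h2]|no] := pselect (L z y); first by exists y0.
  by exists (0, 0).
have [y0 y0P] := choice pts.
exists [seq (h y / gen_scale, MkFgen z a b c (y0 y)) | y <- l].
  move=> p /List.in_map_iff[y [<- yl]].
  have Ly : L z y.
    by apply: lL; elim: (l) yl => //= t l' IH [->|/IH h']; rewrite inE ?eqxx// h' orbT.
  have [yd yE] := y0P _ Ly; split=> /=; first by case: pf => ? ? ? _; split.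
  have [|K hK] := @fa_coef_bound (y0 y); first by rewrite yE.
  by move=> tau ut; exact: qconv_cubic hK.
move=> n; rewrite big_map.
rewrite -(fsum_partition (h := rep) (l := l) G (finite_lattice_sphere n))//; last first.
  by move=> x [Lx _]; exact: repl.
rewrite big_seq [RHS]big_seq; apply: eq_bigr => y yl /=.
have [_ yE] := y0P _ (lL _ yl).
rewrite fa_coefE yE mulrA divfK ?gen_scale_neq0// mulr_fsumr.
have -> : [set x | lattice_cong x y /\ a%:~R * (x * cj x) = n%:R] =
    lattice_sphere n `&` [set x | rep x = y].
  apply/seteqP; split=> [x [xy nx]|x [[Lx nx] /= e]].
    have Lx := lattice_cong_lat (lL _ yl) xy.
    by split=> //; apply/repP.
  by split=> //; apply/repP.
apply: eq_fsbigr => x /set_mem[[Lx _] /= e].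
by rewrite -(hP y)//; apply/repP.
Qed.

End Generators.

(** * Theta functions as combinations of the generators *)

Section ThetaSpan.
Variables (R : realType) (D : int) (hD : neg_fund_disc D) (f : nat) (f0 : (0 < f)%N).
Local Notation C := R[i].
Local Notation cj := (@conjc R).
Local Notation L := (@lattice_tau R).
Local Notation O := (@OK R D).
Local Notation delta := (f%:R * sqrtD R D).
Implicit Types I J : set C.

(** The inverse lattice at x has norm a |x|^2 as an ideal product, and this agrees with the residue
    count. *)
Lemma lattice_sphere_idnorm z a b c x n : primitive_form D z a b c -> x != 0 -> L z x ->
  lattice_sphere z a n x <-> idnorm D (inv_lattice a z x) n.
Proof.
move=> pf x0 Lx; have hI := inv_lattice_ideal hD pf x0 Lx.
have hN := inv_lattice_norm hD pf x.
have N0 : 0 < a%:~R * (x * cj x).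
  have xx : x * cj x != 0 by rewrite mulf_neq0// conjc_eq0.
  rewrite mulr_gt0//; first by case: pf => a0 _ _ _; rewrite ltr0z.
  by move: xx; rewrite lt_def => ->; rewrite mul_conj ler0c addr_ge0// sqr_ge0.
split=> [[_ e]|/(idnormP hD _ hI)[n0 h]].
  by apply/(idnormP hD _ hI); split; [rewrite -(ltr0n C) -e|rewrite -e].
by split=> //; apply: (has_norm_uniq hD N0 _ hN h); rewrite ltr0n.
Qed.

Variables (cf q K : set C) (phi : set C -> C) (zs : seq C).
Hypotheses (hz : cm_reps D zs) (hcf : is_ideal D cf) (hphi : hecke_mod D cf phi).
Hypotheses (hq : is_ideal D q) (hK : is_ideal D K).
Hypothesis cE : principal D delta = idmul (idmul q K) cf.

Lemma idmul_inj I J : is_ideal D I -> is_ideal D J -> idmul q I = idmul q J -> I = J.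
Proof.
move=> hI hJ e; apply/seteqP; split=> x Ix.
  by apply: (ideal_cancel hD hq (ideal_module hJ)) => t qt; rewrite -e; exact: idmul_mem.
by apply: (ideal_cancel hD hq (ideal_module hI)) => t qt; rewrite e; exact: idmul_mem.
Qed.

Definition ideals_above (n : nat) : set (set C) :=
  [set I | [/\ is_ideal D I, coprime_id D I cf & idnorm D (idmul q I) n]].

Section OneClass.
Variables (cls : set C -> C).
Hypothesis cls_in : forall I, is_ideal D I -> cls I \in zs.
Hypothesis clsP : forall I, is_ideal D I -> forall a b c,
  primitive_form D (cls I) a b c ->
  exists x, [/\ x != 0, L (cls I) x & idmul q I = inv_lattice a (cls I) x].

Lemma class_span z : z \in zs ->
  (forall n, finite_set (ideals_above n `&` [set I | cls I = z])) /\
  exists2 l : seq (C * Fgen R), (forall p, List.In p l -> valid_gen D f zs p.2 /\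
      forall tau, upper tau -> exists v, qconv (fa_coef D f p.2) tau v) &
    forall n, \sum_(p <- l) p.1 * fa_coef D f p.2 n =
              \sum_(I \in ideals_above n `&` [set I | cls I = z]) phi I.
Proof.
move=> zin; have [a [b [c pf]]] := cm_reps_form hD hz zin.
pose quo x : set (set C) :=
  [set I | [/\ is_ideal D I, coprime_id D I cf & inv_lattice a z x = idmul q I]].
(* Cancelling [q] makes the ideal in [quo x] unique, so the choice is forced on [T]; the default
   [set0] occurs only outside [T], where [G] is set to 0. *)
pose iota x := xget set0 (quo x).
pose T : set C := [set x | exists I, quo x I].
have iotaE x I : quo x I -> iota x = I.
  move=> hI; apply: xget_unique => // J [hJ _ eJ]; case: hI => hI _ eI.
  by apply: idmul_inj => //; rewrite -eJ.
have iotaP x : T x -> quo x (iota x) by move=> [I hI]; rewrite (iotaE _ _ hI).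
have T0 x : T x -> x != 0.
  move=> [I [hI _ e]]; apply/eqP => x0.
  have [_ _ _ _ [y [+ y0]]] := idmul_ideal hq hI.
  by rewrite -e x0 => -[t _]; rewrite mul0r => y00; move: y0; rewrite -y00 eqxx.
have TL x : T x -> L z x.
  move=> [I [hI _ e]]; apply: (inv_lattice_mem hD pf).
  by rewrite e; case: (idmul_ideal hq hI).
pose G x := if x \in T then phi (iota x) else 0.
have GE x I : quo x I -> G x = phi I.
  by move=> hI; rewrite /G mem_set ?(iotaE _ _ hI)//; exists I.
have G0 : G 0 = 0 by rewrite /G memNset// => /T0; rewrite eqxx.
have Tshift x x' I : x != 0 -> x' != 0 -> lattice_cong D f z x x' -> quo x I ->
    exists2 I', quo x' I' & phi I' * x = phi I * x'.
  move=> x0 x0' [l Ll e] [hI copI eI].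
  have [I' [h1 h2 h3 h4]] :=
    hecke_shift hD hcf hphi hq hK cE pf x0 x0' Ll e hI copI eI.
  by exists I'.
have Gcong x x' : L z x -> L z x' -> lattice_cong D f z x x' -> G x * x' = G x' * x.
  move=> Lx Lx' xx'.
  have [->|x0] := eqVneq x 0; first by rewrite G0 mul0r mulr0.
  have [->|x0'] := eqVneq x' 0; first by rewrite G0 mul0r mulr0.
  have [[I hI]|nT] := pselect (T x).
    have [I' hI' e] := Tshift _ _ _ x0 x0' xx' hI.
    by rewrite (GE _ _ hI) (GE _ _ hI') e.
  (* If [x'] were in [T], shifting back would put [x] in [T]; so both values are the default 0. *)
  rewrite /G memNset// memNset ?mul0r// => -[I' hI'].
  have [I hI _] := Tshift _ _ _ x0' x0 (lattice_cong_sym xx') hI'.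
  by apply: nT; exists I.
pose A n := lattice_sphere z a n `&` T.
pose B n := ideals_above n `&` [set I | cls I = z].
have finA n : finite_set (A n) by apply: finite_setIl; exact: (finite_lattice_sphere hD pf).
have AB n x : A n x -> B n (iota x).
  move=> [Sx Tx]; have [hI copI eI] := iotaP _ Tx.
  split; first split=> //.
    by rewrite -eI; apply/(lattice_sphere_idnorm _ pf (T0 _ Tx) (TL _ Tx)).
  have [a' [b' [c' pf']]] := cm_reps_form hD hz (cls_in hI).
  have [x' [x0' Lx' e']] := clsP hI pf'.
  apply: (ideal_class_uniq hz (cls_in hI) zin pf' pf x0' (T0 _ Tx)).
  by rewrite -e' eI.
have BA n I : B n I -> exists2 x, A n x & iota x = I.
  move=> [[hI copI nI] /= clsI].
  have [|x [x0 Lx eI]] := clsP hI (a := a) (b := b) (c := c); first by rewrite clsI.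
  rewrite clsI in Lx eI.
  have qx : quo x I by split.
  exists x; last exact: iotaE.
  split; last by exists I.
  by apply/(lattice_sphere_idnorm _ pf x0 Lx); rewrite -eI.
have finB n : finite_set (B n).
  apply: sub_finite_set (finite_image iota (finA n)).
  by move=> I /BA[x Ax e]; exists x.
pose W := \sum_(u \in @OK_unit R D) (1 : C).
have W0 : W != 0 by exact: units_count.
(* All points over [I] are unit multiples of one [x0], and units do not change the norm, so the
   fibre has the size of the unit group. *)
have fibers n I : B n I -> \sum_(x \in A n `&` [set x | iota x = I]) (1 : C) = W.
  move=> /BA[x0 [Sx0 Tx0] e0]; have [hI copI eI] := iotaP _ Tx0.
  rewrite e0 in hI copI eI; have x00 := T0 _ Tx0; have Lx0 := TL _ Tx0.
  rewrite (@reindex_fsbig _ _ _ _ _ (fun u => u * x0) (@OK_unit R D))//; split.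
  - move=> u hu; have [u0 Ou Ou'] := hu.
    have ux0 : u * x0 != 0 by rewrite mulf_neq0.
    have Lux : L z (u * x0) by exact: (lat_OK hD pf).
    have eu : inv_lattice a z x0 = inv_lattice a z (u * x0).
      by apply/(inv_lattice_units hD pf) => //; rewrite mulfK.
    have qu : quo (u * x0) I by split=> //; rewrite -eu.
    split=> /=; last exact: iotaE.
    split; last by exists I.
    apply/(lattice_sphere_idnorm _ pf ux0 Lux); rewrite -eu.
    by apply/(lattice_sphere_idnorm _ pf x00 Lx0).
  - by move=> u v _ _ /(mulIf x00).
  - move=> x [[Sx Tx] /= ex]; have [_ _ ex'] := iotaP _ Tx; rewrite ex in ex'.
    exists (x / x0); last by rewrite divfK.
    by apply/(inv_lattice_units hD pf) => //; [exact: T0|rewrite ex' eI].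
split=> // {finB}.
have [l lP lE] := span_of_equivariant hD f0 pf (G := fun x => W^-1 * G x) zin
  (etrans (congr1 _ G0) (mulr0 _))
  (fun x x' Lx Lx' h => etrans (esym (mulrA _ _ _))
     (etrans (congr1 _ (Gcong x x' Lx Lx' h)) (mulrA _ _ _))).
exists l => // n; rewrite lE -mulr_fsumr -fsbig_mkcondr.
rewrite (fsum_fibers (B := B n) phi (finA n) _ (AB n) (fibers n)) ?mulKf//.
apply: sub_finite_set (finite_image iota (finA n)).
by move=> I /BA[x Ax e]; exists x.
Qed.

End OneClass.

(** Each ideal [I] is sorted by the class of [q I]; the combinations found for the single
    representatives are concatenated. *)
Lemma theta_span : exists2 l : seq (C * Fgen R),
  (forall p, List.In p l -> valid_gen D f zs p.2 /\
      forall tau, upper tau -> exists v, qconv (fa_coef D f p.2) tau v) &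
  forall n, \sum_(p <- l) p.1 * fa_coef D f p.2 n = \sum_(I \in ideals_above n) phi I.
Proof.
have [cls clsP] : {cls : set C -> C & forall I, is_ideal D I -> cls I \in zs /\
    forall a b c, primitive_form D (cls I) a b c ->
    exists x, [/\ x != 0, L (cls I) x & idmul q I = inv_lattice a (cls I) x]}.
  apply: (@choice _ _ (fun I z => is_ideal D I -> z \in zs /\ forall a b c,
    primitive_form D z a b c ->
    exists x, [/\ x != 0, L z x & idmul q I = inv_lattice a z x])) => I.
  have [hI|no] := pselect (is_ideal D I); last by exists 0.
  by have [z zin hzI] := ideal_class hD hz (idmul_ideal hq hI); exists z.
have cls_in I (hI : is_ideal D I) := (clsP I hI).1.
have span := class_span cls_in (fun I hI => (clsP I hI).2).
have [l lP] : {l : C -> seq (C * Fgen R) & forall z, z \in zs ->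
   (forall p, List.In p (l z) -> valid_gen D f zs p.2 /\
      forall tau, upper tau -> exists v, qconv (fa_coef D f p.2) tau v) /\
    forall n, \sum_(p <- l z) p.1 * fa_coef D f p.2 n =
              \sum_(I \in ideals_above n `&` [set I | cls I = z]) phi I}.
  apply: (@choice _ _ (fun z l => z \in zs ->
   (forall p, List.In p l -> valid_gen D f zs p.2 /\
      forall tau, upper tau -> exists v, qconv (fa_coef D f p.2) tau v) /\
    forall n, \sum_(p <- l) p.1 * fa_coef D f p.2 n =
              \sum_(I \in ideals_above n `&` [set I | cls I = z]) phi I)) => z.
  have [/span[_ [l l1 l2]]|no] := boolP (z \in zs); last by exists [::].
  by exists l => _; split.
exists (flatten [seq l z | z <- zs]).
  move=> p; have sub : {subset zs <= zs} by [].
  elim: {1 3}zs sub => //= z zs' IH sub hp.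
  case: (List.in_app_or _ _ _ hp) => [|/IH]; last first.
    by apply=> t tz; apply: sub; rewrite inE tz orbT.
  by have [h _] := lP z (sub _ (mem_head _ _)); exact: h.
move=> n; rewrite big_flatten big_map.
rewrite -(@fsum_partition _ _ _ (ideals_above n) zs cls)//; first last.
- by move=> I [hI _ _]; exact: cls_in.
- exact: (cm_reps_uniq hz).
- apply: (@sub_finite_set _ _ (\bigcup_(z in [set` zs])
      (ideals_above n `&` [set I | cls I = z]))).
    by move=> I hI; exists (cls I) => //; case: hI => hI _ _; exact: cls_in.
  by apply: bigcup_finite => [|z /= zin]; [exact: finite_seq|exact: (span z zin).1].
rewrite big_seq [RHS]big_seq; apply: eq_bigr => z zin.
by have [_ ->] := lP z zin.
Qed.

Lemma idnorm_mul I d' m : is_ideal D I -> idnorm D q d' -> idnorm D I m ->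
  idnorm D (idmul q I) (d' * m).
Proof.
move=> hI /(idnormP hD _ hq)[d0 h1] /(idnormP hD _ hI)[m0 h2].
apply/(idnormP hD); first exact: idmul_ideal.
by rewrite muln_gt0 d0 m0 natrM; split=> //; exact: has_normM.
Qed.

(** Since q I has norm d' Nm(I), the combination from [theta_span] has coefficients supported on
    multiples of [d']: its series at tau is the theta series at d' tau. *)
Lemma theta_slash_span (d' : nat) : idnorm D q d' ->
  exists2 l : seq (C * Fgen R), (forall p, List.In p l -> valid_gen D f zs p.2) &
  forall tau, upper tau ->
    slash_diag d' (theta D cf phi) tau = \sum_(p <- l) p.1 * fa D f p.2 tau.
Proof.
move=> nq; have [d0 _] := (idnormP hD _ hq).1 nq.
have [l lP lE] := theta_span.
exists [seq (d'%:R * p.1, p.2) | p <- l].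
  by move=> p /List.in_map_iff[p' [<- /lP[]]].
move=> tau ut; rewrite /slash_diag big_map /=.
under eq_bigr do rewrite -mulrA.
rewrite -mulr_sumr; congr (_ * _); apply: qvalE.
apply: (@qconv_spread _ _ _ (fun n => \sum_(p <- l) p.1 * fa_coef D f p.2 n)) => //.
- move=> m; rewrite lE /theta_coef.
  suff -> : ideals_above (d' * m) =
    [set I | [/\ is_ideal D I, coprime_id D I cf & idnorm D I m]] by [].
  apply/seteqP; split=> I [hI copI nI]; split=> //; last exact: idnorm_mul.
  have [m' [_ h _]] := idnorm_exists hD hI.
  have := idnorm_uniq (ideal_module (idmul_ideal hq hI)) (idnorm_mul hI nq h) nI.
  by move/eqP; rewrite eqn_pmul2l// => /eqP <-.
- move=> n nd; rewrite lE fsbig1// => I [hI _ nI]; exfalso.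
  have [m' [_ h _]] := idnorm_exists hD hI.
  have e := idnorm_uniq (ideal_module (idmul_ideal hq hI)) (idnorm_mul hI nq h) nI.
  by move: nd; rewrite -e dvdn_mulr.
apply: (@qconv_sum _ _ l (fun p => p.1) (fun p => fa_coef D f p.2)) => p /lP[_ hp].
by have [v hv] := hp _ ut; rewrite /fa (qvalE hv).
Qed.

End ThetaSpan.

Theorem theorem3p5p1 (R : realType) (D : int) (f_rho d : nat)
    (zs : seq R[i]) (cf : set R[i]) (phi : set R[i] -> R[i]) :
  neg_fund_disc D ->
  (0 < f_rho)%N -> (0 < d)%N ->
  cm_reps D zs ->
  hecke_char_conductor D cf phi ->
  (* c_f divides  c = f_rho sqrt(D_K) O_K *)
  iddvd D cf (principal D (f_rho%:R * sqrtD R D)) ->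
  in_union_iota D f_rho d zs (theta D cf phi) /\
  (forall (d'' : nat) (q : set R[i]) (d' : nat),
     (0 < d'')%N -> (d'' %| d ^ 2)%N ->
     is_ideal D q ->
     (* q divides c * c_f^{-1}, i.e.  c = q * K * c_f  for an integral ideal K *)
     (exists K, is_ideal D K /\
        principal D (f_rho%:R * sqrtD R D) = idmul (idmul q K) cf) ->
     idnorm D q d' ->
     in_union_iota D f_rho d zs (slash_diag (d' * d'') (theta D cf phi))).
Proof.
move=> hD f0 d0 hz [hcf hphi _] [K0 [hK0 cE0]].
have slashes (d'' : nat) (q : set R[i]) (d' : nat) :
     (0 < d'')%N -> (d'' %| d ^ 2)%N -> is_ideal D q ->
     (exists K, is_ideal D K /\
        principal D (f_rho%:R * sqrtD R D) = idmul (idmul q K) cf) ->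
     idnorm D q d' ->
     in_union_iota D f_rho d zs (slash_diag (d' * d'') (theta D cf phi)).
  move=> d1 d2 hq [K [hK cE]] nq.
  have [l lP lE] := theta_slash_span hD f0 hz hcf hphi hq hK cE nq.
  (* Slashing by [d' * d''] is slashing by [d'], which already lands in the span, and then by
     [d'']. *)
  exists d''; split=> //; exists l; split=> // tau ut.
  have ut' : upper (d''%:R * tau).
    by rewrite /upper -[d''%:R]/(d''%:Z%:~R) Im_intM mulr_gt0// ltr0z ltz_nat.
  by rewrite [RHS]/slash_diag -lE// /slash_diag natrM mulrA [_%:R * d'%:R]mulrC mulrA.
split=> //.
(* The theta function itself is the case of the unit ideal with both factors equal to 1. *)
have -> : theta D cf phi = slash_diag (1 * 1) (theta D cf phi).
  by apply/funext => tau; rewrite /slash_diag mul1r mul1r.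
apply: (slashes 1%N (@OK R D)) => //.
- exact: OK_ideal.
- by exists K0; split=> //; rewrite idmul_OKl ?(idmulC K0)//; exact: ideal_module.
(* The order has a single residue class modulo itself, represented by 0. *)
exists (fun=> 0); split=> [_|x Ox]; first exact: OK0.
by exists ord0; split=> [|i _]; [rewrite subr0|rewrite (ord1 i)].
Qed.
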